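(* Let $M$ be an oriented conformal $4$-manifold with a selfdual conformal submersion $\xi$ over a $3$-manifold $B$ and suppose that $J$ is an antiselfdual almost complex structure on $M$ which is invariant, i.e. $\mathcal L^0_\xi J=0$. Let $\chi=J\xi$ and let $D=D^{sd}-\kappa\xi-\tau\chi$ for basic sections $\tau$ and $\kappa$ of $L^{-1}$. Then $DJ=0$ if and only if $$D^B\chi=\tau(\mathrm{id}-\chi\otimes\chi)+\kappa\,{*_B\chi}$$ on $B$, i.e. $D^B_X\chi=\tau(X-\langle\chi,X\rangle\chi)+\kappa\,\iota_X{*_B\chi}$ for all $X\in TB$. Hence $J$ is integrable if and only if $\chi$ is a shear-free geodesic congruence on $B$, in the sense that $D^B\chi=\tau(\mathrm{id}-\chi\otimes\chi)+\kappa\,{*_B\chi}$ for some sections $\tau,\kappa$ of $L_B^{-1}$.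
   Context: Everything is smooth and local. On an $n$-manifold $M$, $L^w$ is the oriented real line bundle of densities of weight $w$, associated to the frame bundle by the representation $A\mapsto|\det A|^{w/n}$ of $GL(n)$; $L=L^1$. Sections of $L^w\otimes(TM)^{\otimes j}\otimes(T^*M)^{\otimes k}$ have weight $w+j-k$ (''weightless'' means weight $0$). A conformal structure $\mathsf c$ is a (unit determinant) metric on $L^{-1}TM$, i.e. an $L^2$-valued inner product $\langle\cdot,\cdot\rangle$ on $TM$; it identifies vectors and $1$-forms of the same weight. A Weyl derivative $D$ is a covariant derivative on $L$ (hence on every $L^w$); its curvature is a $2$-form $F^D$. On a conformal manifold $D$ determines a unique torsion-free connection on $TM$, also denoted $D$, with $D\mathsf c=0$; for a $1$-form $\gamma$, $(D+\gamma)_XY=D_XY+\gamma(X)Y+\gamma(Y)X-\langle X,Y\rangle\gamma$. A congruence is a section $\xi$ of $L^{-1}TM$ with $\langle\xi,\xi\rangle=1$, also viewed as a weightless $1$-form; $\mathcal H=\xi^\perp$. Its minimal Weyl derivative $D^0$ is the unique Weyl derivative with $D^0_\xi\xi=0$ and $\mathrm{tr}\,D^0\xi=0$; $F^0$ is its Faraday curvature. The Weyl-Lie derivative is $\mathcal L^0_\xi s=\mu^{-1}\mathcal L_{\mu\xi}s+\rho(\mu^{-1}D^0\mu\otimes\xi)s$ for any nonvanishing section $\mu$ of $L$, where $\rho$ is the action of $\mathfrak{gl}(TM)$ on the tensor bundle containing $s$. $\xi$ is a conformal submersion over $B$ if it is tangent to the (oriented, one dimensional) fibres of a surjective submersion $\pi\colon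 M\to B$ onto a conformal manifold with $d\pi_x|_{\mathcal H_x}$ a nonzero conformal linear map for all $x$. Then $\mathcal H\cong\pi^*TB$ and $L\cong\pi^*L_B$; horizontal tensors or densities pulled back from $B$ are called basic (equivalently, horizontal with $\mathcal L^0_\xi=0$). Let $n=4$, $M$ oriented. The star operator is extended to forms of any weight, with the convention that $*1$ is the orientation and $\iota_X{*\alpha}=*(\langle X,\cdot\rangle\wedge\alpha)$; on $2$-forms $*^2=1$. The same convention is used for $*_B$ on $B$ (so $*_B^2=-1$), with orientations related by $*1=*_B1\wedge\xi$. Skew endomorphisms $J$ of $TM$ correspond to $2$-forms $\Omega_J(X,Y)=\langle JX,Y\rangle$ and are (anti)selfdual if $\Omega_J$ is. Put $\omega=-( *d^D\xi)(\xi,\cdot)$ (independent of the Weyl derivative $D$), $D^{sd}=D^0+\frac12\omega$ and $D^B=D^0+\omega$. $\xi$ is selfdual if $F^0$ is selfdual; then $D^B$ is the pullback of a Weyl derivative on $B$, also denoted $D^B$. Since $J$ is invariant, $\chi=J\xi$ is a basic horizontal weightless unit vector field and descends to a section of $L_B^{-1}TB$. $\tau$ and $\kappa$ are called the divergence and twist of $\chi$. *)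

(* Defs.v *)
From HB Require Import structures.
From mathcomp Require Import all_boot all_order all_algebra.
From mathcomp Require Import all_classical all_reals all_analysis.

Set Implicit Arguments.
Unset Strict Implicit.
Unset Printing Implicit Defensive.

Import Order.TTheory GRing.Theory Num.Theory.
Import numFieldNormedType.Exports.

Local Open Scope classical_set_scope.
Local Open Scope ring_scope.

(* Tangent vectors and 1-forms are row vectors of components, an endomorphism
   A acts by X |-> X *m A, and a bilinear form b by (X, Y) |-> X *m b *m Y^T.
   Densities and weighted tensors are given in each chart by their components
   with respect to the coordinate frame and the trivialisation of L^w which
   that frame induces. *)

Definition smooth_on (R : realType) (n : nat) (V : normedModType R)
    (U : set 'rV[R]_n) (f : 'rV[R]_n -> V) : Prop :=
  forall (s : seq 'rV[R]_n) (u : 'rV[R]_n), U u ->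
    differentiable (foldr (fun v h => 'D_v h) f s) u.

(* [param i] inverts [coord i]; its values off the image of the chart are
   irrelevant. *)
Record oriented_manifold (R : realType) (n : nat) := OrientedManifold {
  carrier :> topologicalType;
  chart : Type;
  dom : chart -> set carrier;
  coord : chart -> carrier -> 'rV[R]_n;
  param : chart -> 'rV[R]_n -> carrier;
  manifold_hausdorff : hausdorff_space carrier;
  manifold_second_countable : @second_countable carrier;
  dom_cover : forall p : carrier, exists i, dom i p;
  dom_open : forall i, open (dom i);
  coordK : forall i p, dom i p -> param i (coord i p) = p;
  coord_continuous : forall i p, dom i p -> {for p, continuous (coord i)};
  coord_open : forall i (U : set carrier),
    open U -> U `<=` dom i -> open (coord i @` U);
  transition_smooth : forall i j,
    smooth_on (coord i @` (dom i `&` dom j)) (coord j \o param i);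
  transition_oriented : forall i j (u : 'rV[R]_n),
    (coord i @` (dom i `&` dom j)) u ->
    0 < \det ('J (coord j \o param i) u) }.

Section Algebra.
Context {R : realType}.

Definition ip (n : nat) (b : 'M[R]_n) (X Y : 'rV[R]_n) : R :=
  (X *m b *m Y^T) 0 0.

Definition pairing (n : nat) (a X : 'rV[R]_n) : R := (X *m a^T) 0 0.

(* The orientation *1, a section of L^n (x) Lambda^n T*M: in an oriented chart
   its component is the determinant. *)
Definition vol (n : nat) (v : n.-tuple 'rV[R]_n) : R :=
  \det (\matrix_(i < n) tnth v i).

(* iota_X ( * alpha) = * (<X,.> /\ alpha) gives * <X,.> = iota_X (vol) and
   * (<X,.> /\ <Y,.>) = vol (Y, X, ., .); note the order of X and Y. *)
Definition star1 (X : 'rV[R]_3) : 'M[R]_3 :=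
  \matrix_(a < 3, b < 3) vol [tuple X; delta_mx 0 a; delta_mx 0 b].

Definition star2 (g F : 'M[R]_4) : 'M[R]_4 :=
  \matrix_(c < 4, d < 4)
    (2^-1 * \sum_(a < 4) \sum_(b < 4)
       (invmx g *m F *m invmx g) a b *
       vol [tuple delta_mx 0 b; delta_mx 0 a; delta_mx 0 c; delta_mx 0 d]).

End Algebra.

(* Operations on component functions in one chart; [c] is the conformal
   structure, [th] the 1-form of the Weyl derivative, D s = ds + w s th on
   sections s of L^w. *)
Section LocalCalculus.
Context {R : realType} {n : nat}.
Local Notation V := 'rV[R]_n.
Implicit Types (c : V -> 'M[R]_n) (th : V -> V) (w : R) (X Y Z u : V).

Definition cov_density th w X (s : V -> R) u : R :=
  'D_X s u + w * pairing (th u) X * s u.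

(* D_X Y for the coordinate vector fields X and Y, where D is the torsion-free
   connection with D c = 0: the Koszul formula, in which the inner product of
   vectors is a section of L^2. *)
Definition koszul c th u X Y Z : R :=
  2^-1 * (cov_density th 2 X (fun v => ip (c v) Y Z) u
        + cov_density th 2 Y (fun v => ip (c v) X Z) u
        - cov_density th 2 Z (fun v => ip (c v) X Y) u).

Definition christoffel c th u X Y : V :=
  (\row_(k < n) koszul c th u X Y (delta_mx 0 k)) *m invmx (c u).

(* D_X Y for a section Y of L^w (x) TM. *)
Definition cov c th w X (Y : V -> V) u : V :=
  'D_X Y u + christoffel c th u X (Y u) + (w * pairing (th u) X) *: Y u.

(* (D_X J) Y, with Y extended by constant components. *)
Definition cov_endo c th X (J : V -> 'M[R]_n) Y u : V :=
  cov c th 0 X (fun v => Y *m J v) u - cov c th 0 X (cst Y) u *m J u.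

(* d^D a for a section a of L^w (x) T*M. *)
Definition ext_d th w (a : V -> V) u : 'M[R]_n :=
  \matrix_(i < n, j < n)
    (cov_density th w (delta_mx 0 i) (fun v => a v 0 j) u
   - cov_density th w (delta_mx 0 j) (fun v => a v 0 i) u).

Definition faraday th u : 'M[R]_n := ext_d th 0 th u.

Definition lie (X Y : V -> V) u : V := 'D_(X u) Y u - 'D_(Y u) X u.

(* (L_X J) Y *)
Definition lie_endo (X : V -> V) (J : V -> 'M[R]_n) Y u : V :=
  lie X (fun v => Y *m J v) u - lie X (cst Y) u *m J u.

(* (L^0_xi J) Y, computed with the section m of L; A = m^-1 D^0 m (x) xi acts
   on endomorphisms by the commutator. *)
Definition weyl_lie (xi th : V -> V) (m : V -> R) (J : V -> 'M[R]_n) Y u : V :=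
  let A Z := ((m u)^-1 * cov_density th 1 Z m u) *: xi u in
  (m u)^-1 *: lie_endo (fun v => m v *: xi v) J Y u
  + (A (Y *m J u) - A Y *m J u).

(* The Nijenhuis tensor, evaluated on the vector fields X and Y with constant
   components. *)
Definition nijenhuis (J : V -> 'M[R]_n) X Y u : V :=
  lie (fun v => X *m J v) (fun v => Y *m J v) u
  - lie (fun v => X *m J v) (cst Y) u *m J u
  - lie (cst X) (fun v => Y *m J v) u *m J u
  - lie (cst X) (cst Y) u.

End LocalCalculus.

(* The pullback by f of sections of L is s |-> m^-1 * (s \o f) in components;
   th is the pullback of th' if D (f^* s) = f^* (D' s) at u. *)
Definition weyl_pullback_at (R : realType) (n k : nat)
    (f : 'rV[R]_n -> 'rV[R]_k) (m : 'rV[R]_n -> R)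
    (th : 'rV[R]_n -> 'rV[R]_n) (th' : 'rV[R]_k -> 'rV[R]_k)
    (u : 'rV[R]_n) : Prop :=
  forall (X : 'rV[R]_n) (s : 'rV[R]_k -> R), differentiable s (f u) ->
    cov_density th 1 X (fun v => (m v)^-1 * s (f v)) u =
    (m u)^-1 * cov_density th' 1 ('d f u X) s (f u).

Section Fields.
Context {R : realType} {n : nat}.
Variable M : oriented_manifold R n.

Definition img (i : chart M) : set 'rV[R]_n := coord i @` dom i.

Definition overlap (i j : chart M) : set 'rV[R]_n :=
  coord i @` (dom i `&` dom j).

Definition transition (i j : chart M) : 'rV[R]_n -> 'rV[R]_n :=
  coord j \o param i.

Definition jac (i j : chart M) (u : 'rV[R]_n) : 'M[R]_n :=
  'J (transition i j) u.

(* The transition function of L^w. *)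
Definition rescale (w : R) (i j : chart M) (u : 'rV[R]_n) : R :=
  `|\det (jac i j u)| `^ (w / n%:R).

Definition is_density (w : R) (s : chart M -> 'rV[R]_n -> R) : Prop :=
  (forall i, smooth_on (img i) (s i)) /\
  (forall i j u, overlap i j u ->
     s j (transition i j u) = rescale w i j u * s i u).

(* Sections of L^w (x) TM. *)
Definition is_vector (w : R) (Y : chart M -> 'rV[R]_n -> 'rV[R]_n) : Prop :=
  (forall i, smooth_on (img i) (Y i)) /\
  (forall i j u, overlap i j u ->
     Y j (transition i j u) = rescale w i j u *: (Y i u *m jac i j u)).

Definition is_endo (A : chart M -> 'rV[R]_n -> 'M[R]_n) : Prop :=
  (forall i, smooth_on (img i) (A i)) /\
  (forall i j u, overlap i j u ->
     jac i j u *m A j (transition i j u) = A i u *m jac i j u).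

(* Sections c of L^2 (x) S^2 T*M; the metric on L^-1 TM has unit determinant
   exactly when the matrix of components has determinant 1. *)
Definition conformal_structure (c : chart M -> 'rV[R]_n -> 'M[R]_n) : Prop :=
  [/\ forall i, smooth_on (img i) (c i),
      forall i j u, overlap i j u ->
        jac i j u *m c j (transition i j u) *m (jac i j u)^T =
        rescale 2 i j u *: c i u &
      forall i u, img i u ->
        [/\ (c i u)^T = c i u,
            forall X, X != 0 -> 0 < ip (c i u) X X &
            \det (c i u) = 1]].

Definition weyl_derivative (D : chart M -> 'rV[R]_n -> 'rV[R]_n) : Prop :=
  (forall i, smooth_on (img i) (D i)) /\
  (forall i j u, overlap i j u ->
     weyl_pullback_at (transition i j) (rescale 1 i j) (D i) (D j) u).

Definition congruence (c : chart M -> 'rV[R]_n -> 'M[R]_n)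
    (xi : chart M -> 'rV[R]_n -> 'rV[R]_n) : Prop :=
  is_vector (-1) xi /\
  (forall i u, img i u -> ip (c i u) (xi i u) (xi i u) = 1).

Definition minimal_weyl (c : chart M -> 'rV[R]_n -> 'M[R]_n)
    (xi D0 : chart M -> 'rV[R]_n -> 'rV[R]_n) : Prop :=
  weyl_derivative D0 /\
  (forall i u, img i u ->
     cov (c i) (D0 i) (-1) (xi i u) (xi i) u = 0 /\
     \sum_(k < n) cov (c i) (D0 i) (-1) (delta_mx 0 k) (xi i) u 0 k = 0).

(* L^0_xi J = 0 *)
Definition invariant_endo (xi D0 : chart M -> 'rV[R]_n -> 'rV[R]_n)
    (J : chart M -> 'rV[R]_n -> 'M[R]_n) : Prop :=
  forall i (m : 'rV[R]_n -> R), smooth_on (img i) m ->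
    (forall u, img i u -> m u != 0) ->
    forall u Y, img i u -> weyl_lie (xi i) (D0 i) m (J i) Y u = 0.

(* D J = 0 *)
Definition parallel_endo (c : chart M -> 'rV[R]_n -> 'M[R]_n)
    (D : chart M -> 'rV[R]_n -> 'rV[R]_n)
    (J : chart M -> 'rV[R]_n -> 'M[R]_n) : Prop :=
  forall i u X Y, img i u -> cov_endo (c i) (D i) X (J i) Y u = 0.

Definition integrable_endo (J : chart M -> 'rV[R]_n -> 'M[R]_n) : Prop :=
  forall i u X Y, img i u -> nijenhuis (J i) X Y u = 0.

End Fields.

Section Dimension4.
Context {R : realType}.
Variable M : oriented_manifold R 4.
Implicit Types (c J : chart M -> 'rV[R]_4 -> 'M[R]_4)
  (xi D : chart M -> 'rV[R]_4 -> 'rV[R]_4).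

(* xi viewed as a weightless 1-form *)
Definition flat c xi (i : chart M) (u : 'rV[R]_4) : 'rV[R]_4 :=
  xi i u *m c i u.

(* omega = - ( * d^D xi)(xi, .), independent of D. *)
Definition omega c xi D (i : chart M) (u : 'rV[R]_4) : 'rV[R]_4 :=
  - (xi i u *m star2 (c i u) (ext_d (D i) 1 (flat c xi i) u)).

Definition selfdual_congruence c D : Prop :=
  forall i u, img i u ->
    star2 (c i u) (faraday (D i) u) = faraday (D i) u.

(* The 2-form of the endomorphism J has matrix J *m c. *)
Definition asd_almost_complex c J : Prop :=
  is_endo J /\
  (forall i u, img i u ->
     [/\ J i u *m J i u = - 1%:M,
         (J i u *m c i u)^T = - (J i u *m c i u) &
         star2 (c i u) (J i u *m c i u) = - (J i u *m c i u)]).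

Definition chi_of xi J (i : chart M) (u : 'rV[R]_4) : 'rV[R]_4 :=
  xi i u *m J i u.

(* With D = D^0, the next three are D^sd, D^B and D^sd - kappa xi - tau chi. *)
Definition weyl_sd c xi D (i : chart M) (u : 'rV[R]_4) : 'rV[R]_4 :=
  D i u + 2^-1 *: omega c xi D i u.

Definition weyl_basic c xi D (i : chart M) (u : 'rV[R]_4) : 'rV[R]_4 :=
  D i u + omega c xi D i u.

Definition weyl_twisted c xi D J (tau kappa : chart M -> 'rV[R]_4 -> R)
    (i : chart M) (u : 'rV[R]_4) : 'rV[R]_4 :=
  weyl_sd c xi D i u - kappa i u *: flat c xi i u
  - tau i u *: flat c (chi_of xi J) i u.

End Dimension4.

Section Submersion.
Context {R : realType}.
Variables (M : oriented_manifold R 4) (B : oriented_manifold R 3).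

Definition common_img (pi : M -> B) (i : chart M) (a : chart B) :
    set 'rV[R]_4 :=
  coord i @` (dom i `&` pi @^-1` dom a).

Definition local_rep (pi : M -> B) (i : chart M) (a : chart B) :
    'rV[R]_4 -> 'rV[R]_3 :=
  coord a \o pi \o param i.

(* mu is the conformal factor of d pi on xi^perp in the given pair of charts;
   it is determined by [csub_conformal].  As <X,Y> and <d pi X, d pi Y> agree
   under L = pi^* L_B, the pullback of a section s of L_B^w has components
   mu^-w * (s \o pi).  [csub_orientation] is *1 = *_B 1 /\ xi. *)
Record conformal_submersion
    (c : chart M -> 'rV[R]_4 -> 'M[R]_4)
    (xi : chart M -> 'rV[R]_4 -> 'rV[R]_4)
    (cB : chart B -> 'rV[R]_3 -> 'M[R]_3)
    (pi : M -> B) (mu : chart M -> chart B -> 'rV[R]_4 -> R) : Prop := {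
  csub_continuous : continuous pi;
  csub_smooth : forall i a,
    smooth_on (common_img pi i a) (local_rep pi i a);
  csub_surjective : forall b : B, exists p : M, pi p = b;
  csub_submersion : forall i a u, common_img pi i a u ->
    forall Y : 'rV[R]_3, exists X, 'd (local_rep pi i a) u X = Y;
  csub_tangent : forall i a u, common_img pi i a u ->
    'd (local_rep pi i a) u (xi i u) = 0;
  csub_factor_gt0 : forall i a u, common_img pi i a u -> 0 < mu i a u;
  csub_conformal : forall i a u, common_img pi i a u -> forall X Y,
    ip (c i u) (xi i u) X = 0 -> ip (c i u) (xi i u) Y = 0 ->
    ip (cB a (local_rep pi i a u))
      ('d (local_rep pi i a) u X) ('d (local_rep pi i a) u Y) =
    mu i a u ^+ 2 * ip (c i u) X Y;
  csub_orientation : forall i a u, common_img pi i a u -> forall X Y Z,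
    vol [tuple X; Y; Z; xi i u] =
    mu i a u ^- 3 * vol [tuple 'd (local_rep pi i a) u X;
      'd (local_rep pi i a) u Y; 'd (local_rep pi i a) u Z] }.

Definition density_pullback (pi : M -> B)
    (mu : chart M -> chart B -> 'rV[R]_4 -> R) (w : R)
    (s : chart M -> 'rV[R]_4 -> R) (sB : chart B -> 'rV[R]_3 -> R) : Prop :=
  forall i a u, common_img pi i a u ->
    s i u = mu i a u `^ (- w) * sB a (local_rep pi i a u).

(* The section Y of L^w (x) xi^perp is the pullback of the section YB of
   L_B^w (x) TB. *)
Definition vector_pullback
    (c : chart M -> 'rV[R]_4 -> 'M[R]_4)
    (xi : chart M -> 'rV[R]_4 -> 'rV[R]_4) (pi : M -> B)
    (mu : chart M -> chart B -> 'rV[R]_4 -> R) (w : R)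
    (Y : chart M -> 'rV[R]_4 -> 'rV[R]_4)
    (YB : chart B -> 'rV[R]_3 -> 'rV[R]_3) : Prop :=
  forall i a u, common_img pi i a u ->
    ip (c i u) (xi i u) (Y i u) = 0 /\
    'd (local_rep pi i a) u (Y i u) =
    mu i a u `^ (- w) *: YB a (local_rep pi i a u).

Definition weyl_pullback (pi : M -> B)
    (mu : chart M -> chart B -> 'rV[R]_4 -> R)
    (D : chart M -> 'rV[R]_4 -> 'rV[R]_4)
    (DB : chart B -> 'rV[R]_3 -> 'rV[R]_3) : Prop :=
  forall i a u, common_img pi i a u ->
    weyl_pullback_at (local_rep pi i a) (mu i a) (D i) (DB a) u.

(* D^B chi = tau (id - chi (x) chi) + kappa *_B chi on B. *)
Definition shear_free_geodesic
    (cB : chart B -> 'rV[R]_3 -> 'M[R]_3)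
    (DB chi : chart B -> 'rV[R]_3 -> 'rV[R]_3)
    (tau kappa : chart B -> 'rV[R]_3 -> R) : Prop :=
  forall a y X, img a y ->
    cov (cB a) (DB a) (-1) X (chi a) y =
    tau a y *: (X - ip (cB a y) (chi a y) X *: chi a y)
    + kappa a y *: (X *m star1 (chi a y) *m invmx (cB a y)).

End Submersion.

(* Main.v *)
Require Import Defs.
From HB Require Import structures.
From mathcomp Require Import all_boot all_order all_algebra.
From mathcomp Require Import all_classical all_reals all_analysis.
From mathcomp Require Import ring lra.

Set Implicit Arguments.
Unset Strict Implicit.
Unset Printing Implicit Defensive.

Import Order.TTheory GRing.Theory Num.Theory.
Import numFieldNormedType.Exports.

Local Open Scope classical_set_scope.
Local Open Scope ring_scope.

(** Both equivalences compare first derivatives at one point, in an orthonormal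
    frame adapted to [xi] and [J]: [e0 = xi], [e1 = J xi = chi], [e2] any unit
    vector orthogonal to both, [e3 = J e2].  Antiselfduality of [J] says that
    this frame is positively oriented ([frame_vol]).

    For a torsion-free [D] with [D c = 0], each [D_X J] is skew and anticommutes
    with [J], hence is determined by the components of [(D_X J) xi] along [e2]
    and [e3] ([nabla_J_eq0]); [D J = 0] is a system of eight scalar equations.
    Invariance of [J] expresses [D^0_xi J] as the commutator of [D^0 xi] and [J].
    As [D^0 xi] is traceless and kills [xi], it must then be skew, and its
    components are those of [(D^0_xi J) xi] and of [omega / 2] ([nabla_xi_frame],
    [pairing_om_frame]).  Consequently, for [D = D^sd - kappa xi - tau chi], the
    two equations with [X = xi] hold, and for horizontal [X] and [Z] the number
    [<(D_X J) xi, Z>] is the defect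
    [<D^B_X chi, Z> - tau (<X,Z> - <chi,X><chi,Z>) - kappa vol (chi, X, Z, xi)]
    of the equation on [B] lifted to [M] ([nabla_chi_twist]).

    The Nijenhuis tensor is a combination of the components of [D J], for any
    such [D]; its vanishing imposes four relations on the eight components, and
    with [(D^0_xi J) xi] known two free parameters remain.  They are [tau] and
    [kappa] ([integrable_iff_parallel]).

    The passage between [M] and [B] rests on one computation
    ([ip_cov_pullback]): if [f^* cB = m^2 (c - eta (x) eta)] and the Weyl
    derivatives correspond under [f], then so do the covariant derivatives of
    projectable fields along the kernel of [eta].  The second derivatives of [f]
    enter the Koszul formula symmetrically and cancel, which is where Schwarz's
    theorem ([derive_sym]) is used.  The case [eta = xi] is the submersion; the
    case [eta = 0] is a change of charts on [B].

    In the converse of the second equivalence [tau] and [kappa] are first found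
    pointwise.  They are half the divergence of [chi] and half the contraction of
    [D^B chi] with the star of [chi], expressions that are smooth in every chart
    ([divergence], [rotation]); being unique, they transform as densities. *)

(** * Differential calculus of matrix-valued functions *)

Section Calculus.
Context {R : realType} {V : normedModType R}.

Lemma differentiable_mxP m n (f : V -> 'M[R]_(m, n)) u :
  differentiable f u <-> forall i j, differentiable (fun v => f v i j) u.
Proof.
split=> [df i j|df].
  apply: (@differentiable_comp _ _ _ _ f (fun N : 'M[R]_(m, n) => N i j : R)) => //.
  exact: differentiable_coord.
have -> : f = \sum_(i < m) \sum_(j < n) (fun v => f v i j *: (delta_mx i j : 'M[R]_(m, n))).
  apply/funext => v; rewrite [LHS]matrix_sum_delta.
  rewrite fct_sumE; apply: eq_bigr => i _.
  by rewrite fct_sumE.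
apply: differentiable_sum => i; apply: differentiable_sum => j.
exact: differentiableZl.
Qed.

Lemma derive_entry m n (f : V -> 'M[R]_(m, n)) u X i j :
  differentiable f u -> 'D_X (fun v => f v i j) u = ('D_X f u) i j.
Proof.
by move=> df; rewrite derive_mx ?mxE//; exact: diff_derivable.
Qed.

Lemma derive_dirD (W : normedModType R) (f : V -> W) u X Y :
  differentiable f u -> 'D_(X + Y) f u = 'D_X f u + 'D_Y f u.
Proof. by move=> df; rewrite !deriveE// linearD. Qed.

Lemma derive_dirZ (W : normedModType R) (f : V -> W) u a X :
  differentiable f u -> 'D_(a *: X) f u = a *: 'D_X f u.
Proof. by move=> df; rewrite !deriveE// linearZ. Qed.

Lemma derive_comp (U W : normedModType R) (f : V -> U) (g : U -> W) u X :
  differentiable f u -> differentiable g (f u) ->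
  'D_X (fun v => g (f v)) u = 'D_('D_X f u) g (f u).
Proof.
move=> df dg; rewrite (deriveE _ dg) (deriveE _ df) deriveE; last exact: differentiable_comp.
by rewrite diff_comp.
Qed.

Lemma differentiable_mulmx m n p (f : V -> 'M[R]_(m, n)) (g : V -> 'M[R]_(n, p)) u :
  differentiable f u -> differentiable g u ->
  differentiable (fun v => f v *m g v) u.
Proof.
move=> /differentiable_mxP df /differentiable_mxP dg.
apply/differentiable_mxP => i j.
have -> : (fun v => (f v *m g v) i j) = \sum_k ((fun v => f v i k) * (fun v => g v k j)).
  by apply/funext => v; rewrite mxE fct_sumE.
by apply: differentiable_sum => k; exact: differentiableM.
Qed.

Lemma derive_mulmx m n p (f : V -> 'M[R]_(m, n)) (g : V -> 'M[R]_(n, p)) u X :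
  differentiable f u -> differentiable g u ->
  'D_X (fun v => f v *m g v) u = 'D_X f u *m g u + f u *m 'D_X g u.
Proof.
move=> df dg; apply/matrixP => i j.
rewrite -derive_entry; last exact: differentiable_mulmx.
have -> : (fun v => (f v *m g v) i j) = \sum_k ((fun v => f v i k) * (fun v => g v k j)).
  by apply/funext => v; rewrite mxE fct_sumE.
have dfe k : derivable (fun v => f v i k) u X.
  by apply: diff_derivable; exact: (differentiable_mxP _ _).1.
have dge k : derivable (fun v => g v k j) u X.
  by apply: diff_derivable; exact: (differentiable_mxP _ _).1.
rewrite derive_sum; last by move=> k; apply: derivableM.
rewrite !mxE -big_split; apply: eq_bigr => k _ /=.
rewrite deriveM// !derive_entry// addrC /GRing.scale/= mulrC; congr (_ + _).
exact: mulrC.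
Qed.

Lemma differentiable_trmx m n (f : V -> 'M[R]_(m, n)) u :
  differentiable f u -> differentiable (fun v => (f v)^T) u.
Proof.
move=> /differentiable_mxP df; apply/differentiable_mxP => i j.
by have -> : (fun v => (f v)^T i j) = (fun v => f v j i) by apply/funext => v; rewrite mxE.
Qed.

Lemma derive_trmx m n (f : V -> 'M[R]_(m, n)) u X :
  differentiable f u -> 'D_X (fun v => (f v)^T) u = ('D_X f u)^T.
Proof.
move=> df; apply/matrixP => i j; rewrite -derive_entry; last exact: differentiable_trmx.
rewrite mxE -derive_entry//; congr ('D_X _ u).
by apply/funext => v; rewrite mxE.
Qed.

Lemma differentiable_ip n (c : V -> 'M[R]_n) (Y Z : V -> 'rV[R]_n) u :
  differentiable c u -> differentiable Y u -> differentiable Z u ->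
  differentiable (fun v => ip (c v) (Y v) (Z v)) u.
Proof.
move=> dc dY dZ.
apply: (differentiable_mxP (fun v => Y v *m c v *m (Z v)^T) u).1.
by apply: differentiable_mulmx; [exact: differentiable_mulmx|exact: differentiable_trmx].
Qed.

Lemma derive_ip n (c : V -> 'M[R]_n) (Y Z : V -> 'rV[R]_n) u X :
  differentiable c u -> differentiable Y u -> differentiable Z u ->
  'D_X (fun v => ip (c v) (Y v) (Z v)) u =
  ip (c u) ('D_X Y u) (Z u) + ip ('D_X c u) (Y u) (Z u) + ip (c u) (Y u) ('D_X Z u).
Proof.
move=> dc dY dZ; rewrite /ip.
have dYc := differentiable_mulmx dY dc.
have dZT := differentiable_trmx dZ.
rewrite (derive_entry X 0 0 (f := fun v => Y v *m c v *m (Z v)^T)); last exact: differentiable_mulmx.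
by rewrite derive_mulmx// derive_mulmx// derive_trmx// mulmxDl !mxE.
Qed.

End Calculus.

(** * Symmetry of second derivatives *)
Section Schwarz.
Context {R : realType} {V : normedModType R}.

Lemma differentiable_approx (g : V -> R) u e : differentiable g u -> 0 < e ->
  \forall h \near (0 : V), `|g (h + u) - g u - 'D_h g u| <= e * `|h|.
Proof.
move=> dg e0.
have := diff_locally dg; set k := 'o _ => dgE.
have : \forall h \near (0 : V), `|k h| <= e * `|h| by exact: (littleoP [littleo of k]).
apply: filterS => h; rewrite deriveE//; congr (`|_| <= _).
have /(congr1 (fun F => F h)) := dgE; rewrite /= => ->.
rewrite !fctE; lra.
Qed.

Let second_difference (f : V -> R) u X Y (t : R) :=
  f (t *: X + t *: Y + u) - f (t *: X + u) - f (t *: Y + u) + f u.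

Lemma is_derive_line (f : V -> R) (w X : V) s : differentiable f (s *: X + w) ->
  is_derive s 1 (fun s => f (s *: X + w)) ('D_X f (s *: X + w)).
Proof.
move=> df.
have dl : is_diff s (fun s : R => s *: X + w) (( *:%R ^~ X) + (cst 0)).
  apply: is_diffD.
have dl1 : differentiable (fun s : R => s *: X + w) s by case: dl.
apply: DeriveDef.
  apply: diff_derivable; exact: (differentiable_comp dl1 df).
rewrite (derive_comp _ dl1 df); congr ('D__ f _).
by rewrite deriveE// diff_val !fctE /= scale1r addr0.
Qed.

Let increment_factor (t a b d x y : R) : 0 < t ->
  (a - b) * t - t ^+ 2 * (t^-1 * (x - y)) = t * ((a - d - x) - (b - d - y)).
Proof. by move=> t0; field; rewrite gt_eqF. Qed.

(** By the mean value theorem in the direction [X] the second difference is [t]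
    times an increment of ['D_X f] along [Y], which differentiability of ['D_X f]
    at [u] estimates.  The second difference is symmetric in [X] and [Y], so the
    two mixed derivatives have the same approximation. *)
Lemma second_difference_approx (f : V -> R) u X Y e : 0 < e ->
  (\forall v \near u, differentiable f v) -> differentiable ('D_X f) u ->
  \forall t \near 0^'+,
    `|second_difference f u X Y t - t ^+ 2 * 'D_Y ('D_X f) u|
      <= e * t ^+ 2 * (`|X| + `|X| + `|Y|).
Proof.
move=> e0 df dg.
set g := 'D_X f.
have H1 : \forall h \near (0 : V), differentiable f (h + u) /\
   `|g (h + u) - g u - 'D_h g u| <= e * `|h|.
  move: df; rewrite (near_shift 0) subr0 => df0.
  by apply: filterS2 df0 (differentiable_approx dg e0) => h.
have [d /= d0 Hd] := (nbhs_ballP _ _).1 H1.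
set K := `|X| + `|X| + `|Y| + 1.
have K0 : 0 < K by rewrite ltr_wpDl// !addr_ge0.
near=> t.
have t0 : 0 < t by near: t; exact: nbhs_right_gt.
have td : t * K < d.
  rewrite -ltr_pdivlMr//; near: t; apply: nbhs_right_lt; exact: divr_gt0.
(* [second_difference f u X Y t = phi t - phi 0] *)
pose phi s := f (s *: X + (t *: Y + u)) - f (s *: X + u).
have small s : s \in `[0, t]%R -> `|s *: X| <= t * `|X|.
  by rewrite in_itv /= => /andP[s0 st]; rewrite normrZ ger0_norm// ler_wpM2r.
have Hd1 h : `|h| <= t * (`|X| + `|Y|) -> differentiable f (h + u) /\
   `|g (h + u) - g u - 'D_h g u| <= e * `|h|.
  move=> hK; apply: Hd; rewrite -ball_normE /= sub0r normrN.
  apply: le_lt_trans td; apply: (le_trans hK); rewrite ler_pM2l// /K.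
  have := normr_ge0 X; lra.
have n1 s : s \in `[0, t]%R -> `|s *: X| <= t * (`|X| + `|Y|).
  move=> /small h; apply: (le_trans h); rewrite ler_pM2l// lerDl//.
have n2 s : s \in `[0, t]%R -> `|s *: X + t *: Y| <= t * (`|X| + `|Y|).
  move=> /small h; apply: (le_trans (ler_normD _ _)); rewrite (normrZ t) (gtr0_norm t0).
  by rewrite mulrDr lerD2r.
pose psi s := g (s *: X + (t *: Y + u)) - g (s *: X + u).
have dphi s : s \in `[0, t]%R -> is_derive s 1 phi (psi s).
  move=> hs; apply: is_deriveB; apply: is_derive_line.
    by rewrite addrA; apply: (Hd1 _ (n2 _ hs)).1.
  exact: (Hd1 _ (n1 _ hs)).1.
have dphi1 s : s \in `]0, t[%R -> is_derive s 1 phi (psi s).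
  by move=> hs; apply: dphi; apply: subset_itv_oo_cc.
have cphi : {within `[0, t], continuous phi}.
  by apply: derivable_within_continuous => s /dphi [].
have [s st E] := MVT t0 dphi1 cphi.
have hs : s \in `[0, t]%R by apply: subset_itv_oo_cc.
have [_ A] := Hd1 _ (n1 _ hs).
have [_ B] := Hd1 _ (n2 _ hs).
have -> : second_difference f u X Y t = phi t - phi 0.
  by rewrite /phi /second_difference !scale0r !add0r !addrA opprB addrA [RHS]addrAC.
rewrite E subr0 /psi addrA.
have -> : 'D_Y g u = t^-1 * ('D_(s *: X + t *: Y) g u - 'D_(s *: X) g u).
  rewrite derive_dirD// derive_dirZ // addrC addKr derive_dirZ//.
  by rewrite /GRing.scale/= mulKf// gt_eqF.
rewrite (increment_factor _ _ (g u))//.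
rewrite normrM (gtr0_norm t0) (mulrC e) expr2 -!mulrA ler_pM2l//.
apply: le_trans (ler_normB _ _) _.
apply: le_trans (lerD B A) _.
rewrite -mulrDr mulrCA ler_pM2l//.
have := small _ hs.
have : `|s *: X + t *: Y| <= t * `|X| + t * `|Y|.
  by rewrite -mulrDr; exact: n2.
move=> h2 h1; apply: le_trans (lerD h2 h1) _.
by rewrite -!mulrDr ler_pM2l// addrAC.
Unshelve. all: by end_near.
Qed.

(** [K + K] exceeds [3 x + 3 y], the sum of the two error coefficients. *)
Let error_bound (e x y t K : R) : K = 2 * (x + y) + 1 + x + y -> 0 < e -> 0 <= x -> 0 <= y -> 0 < t ->
  e / (K + K) * t * (y + y + x) + e / (K + K) * t * (x + x + y) <= t * e.
Proof.
move=> KE e0 x0 y0 t0; have K0 : 0 < K + K by lra.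
have -> : e / (K + K) * t * (y + y + x) + e / (K + K) * t * (x + x + y) =
  t * e * ((3 * x + 3 * y) / (K + K)) by field; rewrite gt_eqF.
rewrite ler_piMr//; first by rewrite ltW// mulr_gt0.
by rewrite ler_pdivrMr// mul1r; lra.
Qed.

Lemma derive_sym_scalar (f : V -> R) u X Y :
  (\forall v \near u, differentiable f v) ->
  differentiable ('D_X f) u -> differentiable ('D_Y f) u ->
  'D_Y ('D_X f) u = 'D_X ('D_Y f) u.
Proof.
move=> df dX dY; apply/eqP; rewrite -subr_eq0 -normr_le0; apply/ler_addgt0Pl => e e0.
rewrite addr0.
set K := 2 * (`|X| + `|Y|) + 1 + `|X| + `|Y|.
have K0 : 0 < K by rewrite /K; have := normr_ge0 X; have := normr_ge0 Y; lra.
have eK : 0 < e / (K + K) by apply: divr_gt0 => //; lra.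
near (0:R)^'+ => t.
have t0 : 0 < t by near: t; exact: nbhs_right_gt.
have A : `|second_difference f u X Y t - t ^+ 2 * 'D_Y ('D_X f) u|
      <= e / (K + K) * t ^+ 2 * (`|X| + `|X| + `|Y|).
  by near: t; exact: second_difference_approx.
have B : `|second_difference f u Y X t - t ^+ 2 * 'D_X ('D_Y f) u|
      <= e / (K + K) * t ^+ 2 * (`|Y| + `|Y| + `|X|).
  by near: t; exact: second_difference_approx.
have S : second_difference f u Y X t = second_difference f u X Y t.
  by rewrite /second_difference (addrC (t *: Y) (t *: X)); congr (_ + _); rewrite addrAC.
rewrite S in B.
have t2 : 0 < t ^+ 2 by rewrite exprn_gt0.
rewrite -(ler_pM2l t2) -{1}(gtr0_norm t2) -normrM.
have key (a b d s : R) : s * (a - b) = (d - s * b) - (d - s * a) by ring.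
rewrite (key _ _ (second_difference f u X Y t)).
apply: le_trans (ler_normB _ _) _.
apply: le_trans (lerD B A) _.
exact: error_bound.
Unshelve. all: by end_near.
Qed.
End Schwarz.

Lemma near_eq_differentiable (R : realType) (V W : normedModType R) (f g : V -> W) u :
  (\forall v \near u, f v = g v) -> differentiable f u -> differentiable g u.
Proof.
move=> fg df; have [dc /eqaddoP E] := (diff_locallyP _ _).1 df.
have E' : g \o shift u = cst (g u) + 'd f u +o_ (0 : V) id.
  apply/eqaddoP => e e0; have Ee := E e e0.
  have fg0 := fg; rewrite (near_shift 0) subr0 in fg0.
  apply: filterS2 fg0 Ee => h /= fgh; congr (`|_| <= _).
  by rewrite -(nbhs_singleton fg); congr (_ + _); rewrite /= fgh.
by apply/diff_locallyP; rewrite (diff_unique dc E').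
Qed.

Lemma derive_sym (R : realType) (V : normedModType R) m n (f : V -> 'M[R]_(m, n)) u X Y :
  (\forall v \near u, differentiable f v) ->
  differentiable ('D_X f) u -> differentiable ('D_Y f) u ->
  'D_Y ('D_X f) u = 'D_X ('D_Y f) u.
Proof.
move=> df dX dY; apply/matrixP => i j.
have E Z : \forall v \near u, ('D_Z f v) i j = 'D_Z (fun v => f v i j) v.
  by apply: filterS df => v dv; rewrite derive_entry.
have E2 Z W : differentiable ('D_Z f) u ->
    ('D_W ('D_Z f) u) i j = 'D_W ('D_Z (fun v => f v i j)) u.
  by move=> dZ; rewrite -derive_entry//; apply: near_eq_derive; exact: E.
have EX := E2 X Y dX.
have EY := E2 Y X dY.
apply: (etrans EX).
apply: (etrans _ (esym EY)).
apply: derive_sym_scalar.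
- by apply: filterS df => v /differentiable_mxP.
- by apply: near_eq_differentiable (E X) _; move/differentiable_mxP: dX.
- by apply: near_eq_differentiable (E Y) _; move/differentiable_mxP: dY.
Qed.

(** * Closure properties of smooth functions *)
Section Smooth.
Context {R : realType} {n : nat}.
Local Notation V := 'rV[R]_n.
Variable U : set V.
Hypothesis openU : open U.

Lemma smooth_on_differentiable (W : normedModType R) (f : V -> W) u :
  smooth_on U f -> U u -> differentiable f u.
Proof. by move=> /(_ [::]); exact. Qed.

Lemma smooth_on_derive (W : normedModType R) (f : V -> W) X :
  smooth_on U f -> smooth_on U ('D_X f).
Proof. by move=> sf s u Uu; have := sf (rcons s X) u Uu; rewrite foldr_rcons. Qed.

Lemma eq_on_near (T : Type) (f g : V -> T) u : (forall v, U v -> f v = g v) -> U u ->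
  \forall v \near u, f v = g v.
Proof. by move=> fg Uu; apply: filterS (open_nbhs_nbhs (conj openU Uu)). Qed.

Lemma smooth_on_near_differentiable (W : normedModType R) (f : V -> W) u :
  smooth_on U f -> U u -> \forall v \near u, differentiable f v.
Proof.
move=> sf Uu; apply: filterS (open_nbhs_nbhs (conj openU Uu)) => v Uv.
exact: smooth_on_differentiable sf Uv.
Qed.

(** The smooth functions are the largest class of differentiable functions on
    [U] that directional derivatives preserve, up to equality on [U]. *)
Lemma smooth_on_coind (W : normedModType R) (P : (V -> W) -> Prop) :
  (forall f, P f -> forall u, U u -> differentiable f u) ->
  (forall f, P f -> forall X, exists2 g, P g & forall u, U u -> 'D_X f u = g u) ->
  forall f, P f -> smooth_on U f.
Proof.
move=> Pd PD f Pf s; have foldr_eq (g h : V -> W) r : (forall u, U u -> g u = h u) ->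
    forall u, U u -> foldr (fun v k => 'D_v k) g r u = foldr (fun v k => 'D_v k) h r u.
  move=> gh; elim: r => //= v r IH u Uu.
  by apply: near_eq_derive; exact: eq_on_near.
elim/last_ind: s f Pf => [|s X IH] f Pf u Uu; first exact: Pd Uu.
rewrite foldr_rcons; have [g Pg fg] := PD f Pf X.
apply: near_eq_differentiable (IH g Pg u Uu).
by apply: eq_on_near Uu => v Uv; apply/esym; exact: foldr_eq.
Qed.

Lemma smooth_on_eq (W : normedModType R) (f g : V -> W) :
  (forall u, U u -> f u = g u) -> smooth_on U f -> smooth_on U g.
Proof.
move=> fg sf.
apply: (smooth_on_coind (P := fun h => exists2 k, smooth_on U k & forall u, U u -> k u = h u)).
- move=> h [k sk kh] u Uu.
  by apply: near_eq_differentiable (smooth_on_differentiable sk Uu); exact: eq_on_near.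
- move=> h [k sk kh] X; exists ('D_X k).
    by exists ('D_X k) => //; exact: smooth_on_derive.
  by move=> u Uu; apply: near_eq_derive; apply: eq_on_near Uu => v Uv; rewrite kh.
- by exists f.
Qed.

(** Closing the smooth functions under sums and products keeps the class stable
    under differentiation by the Leibniz rule, so coinduction applies to it. *)
Inductive smooth_expr : (V -> R) -> Prop :=
| SmoothBase f of smooth_on U f : smooth_expr f
| SmoothAdd f g of smooth_expr f & smooth_expr g : smooth_expr (fun u => f u + g u)
| SmoothMul f g of smooth_expr f & smooth_expr g : smooth_expr (fun u => f u * g u).

Lemma smooth_expr_differentiable f u : smooth_expr f -> U u -> differentiable f u.
Proof.
move=> + Uu; elim=> {f} [f sf|f g _ IHf _ IHg|f g _ IHf _ IHg].
- exact: smooth_on_differentiable sf Uu.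
- exact: differentiableD.
- exact: differentiableM.
Qed.

Lemma smooth_expr_smooth f : smooth_expr f -> smooth_on U f.
Proof.
apply: smooth_on_coind => {f} [f Pf u|f Pf X]; first exact: smooth_expr_differentiable.
elim: Pf => {f} [f sf|f g Pf [f' Pf' ff'] Pg [g' Pg' gg']|f g Pf [f' Pf' ff'] Pg [g' Pg' gg']].
- by exists ('D_X f) => //; apply: SmoothBase; exact: smooth_on_derive.
- exists (fun u => f' u + g' u); first exact: SmoothAdd.
  move=> u Uu; rewrite -ff'// -gg'// -deriveD//; apply: diff_derivable;
  exact: smooth_expr_differentiable.
- exists (fun u => f u * g' u + g u * f' u); first by apply: SmoothAdd; apply: SmoothMul.
  move=> u Uu; rewrite -ff'// -gg'//; apply: deriveM; apply: diff_derivable;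
  exact: smooth_expr_differentiable.
Qed.

Lemma smooth_onD (f g : V -> R) : smooth_on U f -> smooth_on U g ->
  smooth_on U (fun u => f u + g u).
Proof. by move=> sf sg; apply: smooth_expr_smooth; apply: SmoothAdd; exact: SmoothBase. Qed.

Lemma smooth_onM (f g : V -> R) : smooth_on U f -> smooth_on U g ->
  smooth_on U (fun u => f u * g u).
Proof. by move=> sf sg; apply: smooth_expr_smooth; apply: SmoothMul; exact: SmoothBase. Qed.

Lemma smooth_on_cst (a : R) : smooth_on U (fun=> a).
Proof.
apply: (smooth_on_coind (P := fun f => exists a : R, f = cst a)).
- by move=> f [b ->] u _; exact: differentiable_cst.
- move=> f [b ->] X; exists (cst 0); first by exists 0.
  by move=> u _; exact: derive_cst.
- by exists a.
Qed.

Lemma smooth_onN (f : V -> R) : smooth_on U f -> smooth_on U (fun u => - f u).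
Proof.
move=> sf; apply: smooth_on_eq (smooth_onM (smooth_on_cst (-1)) sf) => u _.
by rewrite mulN1r.
Qed.

Lemma smooth_on_sum (I : Type) (r : seq I) (P : pred I) (f : I -> V -> R) :
  (forall i, P i -> smooth_on U (f i)) -> smooth_on U (fun u => \sum_(i <- r | P i) f i u).
Proof.
move=> sf; elim: r => [|i r IH].
  by under eq_fun do rewrite big_nil; exact: smooth_on_cst.
under eq_fun do rewrite big_cons.
by case Pi: (P i) => //; apply: smooth_onD => //; exact: sf.
Qed.

Lemma smooth_on_prod (I : Type) (r : seq I) (P : pred I) (f : I -> V -> R) :
  (forall i, P i -> smooth_on U (f i)) -> smooth_on U (fun u => \prod_(i <- r | P i) f i u).
Proof.
move=> sf; elim: r => [|i r IH].
  by under eq_fun do rewrite big_nil; exact: smooth_on_cst.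
under eq_fun do rewrite big_cons.
by case Pi: (P i) => //; apply: smooth_onM => //; exact: sf.
Qed.

Lemma smooth_on_det k (A : V -> 'M[R]_k) :
  (forall i j, smooth_on U (fun u => A u i j)) -> smooth_on U (fun u => \det (A u)).
Proof.
move=> sA; apply: smooth_on_sum => s _; apply: smooth_onM; first exact: smooth_on_cst.
by apply: smooth_on_prod => i _.
Qed.

Lemma smooth_on_entry p q (A : V -> 'M[R]_(p, q)) i j :
  smooth_on U A -> smooth_on U (fun u => A u i j).
Proof.
move=> sA.
apply: (smooth_on_coind (P := fun f => exists2 B : V -> 'M[R]_(p, q),
   smooth_on U B & f = fun u => B u i j)).
- move=> f [B sB ->] u Uu; apply: (differentiable_mxP B u).1.
  exact: smooth_on_differentiable sB Uu.
- move=> f [B sB ->] X; exists (fun u => 'D_X B u i j).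
    by exists ('D_X B) => //; exact: smooth_on_derive.
  move=> u Uu; apply: derive_entry; exact: smooth_on_differentiable sB Uu.
- by exists A.
Qed.

(** When [det A = 1] the inverse is the adjugate, polynomial in the entries. *)
Lemma smooth_on_invmx k (A : V -> 'M[R]_k) i j :
  (forall u, U u -> \det (A u) = 1) ->
  smooth_on U A -> smooth_on U (fun u => invmx (A u) i j).
Proof.
move=> dA sA; have : smooth_on U (fun u => cofactor (A u) j i).
  apply: smooth_onM; first exact: smooth_on_cst.
  apply: smooth_on_det => a b.
  apply: (@smooth_on_eq _ (fun u => A u (lift j a) (lift i b))).
    by move=> u _; rewrite !mxE.
  exact: smooth_on_entry.
apply: smooth_on_eq => u Uu.
by rewrite /invmx unitmxE dA// unitr1 invr1 scale1r !mxE.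
Qed.

End Smooth.

(** * The Koszul form *)
Section BilinearForm.
Context {R : realType} {n : nat}.
Implicit Types (b C : 'M[R]_n) (X Y Z : 'rV[R]_n).

Lemma ipDl b X Y Z : ip b (X + Y) Z = ip b X Z + ip b Y Z.
Proof. by rewrite /ip !mulmxDl mxE. Qed.
Lemma ipZl b a X Z : ip b (a *: X) Z = a * ip b X Z.
Proof. by rewrite /ip -!scalemxAl mxE. Qed.
Lemma ipNl b X Z : ip b (- X) Z = - ip b X Z.
Proof. by rewrite /ip !mulNmx mxE. Qed.
Lemma ipDr b X Y Z : ip b Z (X + Y) = ip b Z X + ip b Z Y.
Proof. by rewrite /ip linearD mulmxDr mxE. Qed.
Lemma ipZr b a X Z : ip b Z (a *: X) = a * ip b Z X.
Proof. by rewrite /ip linearZ -scalemxAr mxE. Qed.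
Lemma ipNr b X Z : ip b Z (- X) = - ip b Z X.
Proof. by rewrite /ip linearN mulmxN mxE. Qed.
Lemma ip0l b X : ip b 0 X = 0. Proof. by rewrite /ip !mul0mx mxE. Qed.
Lemma ip0r b X : ip b X 0 = 0. Proof. by rewrite /ip trmx0 mulmx0 mxE. Qed.
Lemma ipDm b C X Y : ip (b + C) X Y = ip b X Y + ip C X Y.
Proof. by rewrite /ip mulmxDr mulmxDl mxE. Qed.
Lemma ipZm b a X Y : ip (a *: b) X Y = a * ip b X Y.
Proof. by rewrite /ip -scalemxAr -scalemxAl mxE. Qed.
Lemma ip_tr b X Y : ip b^T X Y = ip b Y X.
Proof.
rewrite /ip; have -> : X *m b^T *m Y^T = (Y *m b *m X^T)^T.
  by rewrite !trmx_mul trmxK mulmxA.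
by rewrite mxE.
Qed.
Lemma ip_sym b X Y : b^T = b -> ip b X Y = ip b Y X.
Proof. by move=> bT; rewrite -ip_tr bT. Qed.
Lemma ip_delta b i j : ip b (delta_mx 0 i) (delta_mx 0 j) = b i j.
Proof. by rewrite /ip -rowE trmx_delta -colE !mxE. Qed.

Lemma pairingD a X Y : pairing a (X + Y) = pairing a X + pairing a Y :> R.
Proof. by rewrite /pairing mulmxDl mxE. Qed.
Lemma pairingZ a t X : pairing a (t *: X) = t * pairing a X :> R.
Proof. by rewrite /pairing -scalemxAl mxE. Qed.
Lemma pairingN a X : pairing a (- X) = - pairing a X :> R.
Proof. by rewrite /pairing mulNmx mxE. Qed.
Lemma pairingDl a a' X : pairing (a + a') X = pairing a X + pairing a' X :> R.
Proof. by rewrite /pairing linearD mulmxDr mxE. Qed.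
Lemma pairingZl a t X : pairing (t *: a) X = t * pairing a X :> R.
Proof. by rewrite /pairing linearZ -scalemxAr mxE. Qed.
Lemma pairingNl a X : pairing (- a) X = - pairing a X :> R.
Proof. by rewrite /pairing linearN mulmxN mxE. Qed.
Lemma pairing_delta (a : 'rV[R]_n) i : pairing a (delta_mx 0 i) = a 0 i.
Proof. by rewrite /pairing -rowE !mxE. Qed.
Lemma pairing_ip b X Y : pairing (X *m b) Y = ip b X Y.
Proof.
rewrite /pairing /ip; have -> : Y *m (X *m b)^T = (X *m b *m Y^T)^T.
  by rewrite [RHS]trmx_mul trmxK.
by rewrite mxE.
Qed.

Lemma linear_formE (f : 'rV[R]_n -> R) Z :
  (forall a X Y, f (a *: X + Y) = a * f X + f Y) ->
  f Z = \sum_k Z 0 k * f (delta_mx 0 k).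
Proof.
move=> lf; have f0 : f 0 = 0.
  by have := lf (-1) 0 0; rewrite scaler0 addr0 mulN1r addNr.
have fD X Y : f (X + Y) = f X + f Y by rewrite -[X]scale1r lf mul1r scale1r.
have fZ a X : f (a *: X) = a * f X by rewrite -[a *: X]addr0 lf f0 addr0.
rewrite {1}[Z]row_sum_delta (big_morph f fD f0).
by apply: eq_bigr => k _; rewrite fZ.
Qed.

Lemma ip_inj C X Y : C \in unitmx -> (forall Z, ip C X Z = ip C Y Z) -> X = Y.
Proof.
move=> uC XY; apply: (can_inj (mulmxK uC)); apply/rowP => j.
by have := XY (delta_mx 0 j); rewrite -!pairing_ip !pairing_delta.
Qed.

(** [<D_X Y, Z>] for constant [X], [Y], [Z], where [dC X] is the derivative along
    [X] of the conformal structure, with value [C], and [t] is the 1-form of the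
    Weyl derivative. *)
Definition koszul_form (dC : 'rV[R]_n -> 'M[R]_n) C (t : 'rV[R]_n) X Y Z : R :=
  2^-1 * (ip (dC X) Y Z + ip (dC Y) X Z - ip (dC Z) X Y)
  + pairing t X * ip C Y Z + pairing t Y * ip C X Z - pairing t Z * ip C X Y.

End BilinearForm.

Section KoszulForm.
Context {R : realType} {n : nat}.
Implicit Types (b : 'M[R]_n) (X Y Z s : 'rV[R]_n).
Variables (dC : 'rV[R]_n -> 'M[R]_n) (C : 'M[R]_n) (t : 'rV[R]_n).
Hypothesis dC_lin : forall a X Y, dC (a *: X + Y) = a *: dC X + dC Y.
Hypothesis C_sym : C^T = C.
Hypothesis dC_sym : forall X, (dC X)^T = dC X.
Local Notation K := (koszul_form dC C t).

Lemma koszul_form_lin a X X' Y Z : K (a *: X + X') Y Z = a * K X Y Z + K X' Y Z.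
Proof.
by rewrite /koszul_form !(dC_lin, ipDm, ipZm, ipDl, ipZl, ipDr, ipZr, pairingD, pairingZ); ring.
Qed.

Lemma koszul_form_linr a X Y Z Z' : K X Y (a *: Z + Z') = a * K X Y Z + K X Y Z'.
Proof.
by rewrite /koszul_form !(dC_lin, ipDm, ipZm, ipDl, ipZl, ipDr, ipZr, pairingD, pairingZ); ring.
Qed.

Lemma koszul_formC X Y Z : K X Y Z = K Y X Z.
Proof.
rewrite /koszul_form (ip_sym X Y C_sym) (ip_sym X Y (dC_sym Z)); ring.
Qed.

Lemma koszul_formZm a X Y Z : K X (a *: Y) Z = a * K X Y Z.
Proof.
have dC0 : dC 0 = 0.
  by have := dC_lin (-1) 0 0; rewrite scaler0 addr0 scaleN1r addNr.
have dCZ V : dC (a *: V) = a *: dC V by rewrite -[a *: V]addr0 dC_lin dC0 addr0.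
by rewrite /koszul_form !(dCZ, ipZm, ipZl, ipZr, pairingZ); ring.
Qed.

(** Symmetrising the Koszul formula in its last two arguments gives [D C = 0]. *)
Lemma koszul_form_metric X Y Z :
  K X Y Z + K X Z Y = ip (dC X) Y Z + 2 * pairing t X * ip C Y Z.
Proof.
rewrite /koszul_form (ip_sym Z Y C_sym) (ip_sym Z Y (dC_sym X)); by field.
Qed.

(** [(D + s)_X Y = D_X Y + s(X) Y + s(Y) X - <X,Y> s] *)
Lemma koszul_form_shift s X Y Z : koszul_form dC C (t + s) X Y Z =
  K X Y Z + pairing s X * ip C Y Z + pairing s Y * ip C X Z - pairing s Z * ip C X Y.
Proof. by rewrite /koszul_form !pairingDl; ring. Qed.

End KoszulForm.

Section Koszul.
Context {R : realType} {n : nat}.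
Local Notation V := 'rV[R]_n.
Variables (c : V -> 'M[R]_n) (th : V -> V) (u : V).
Hypothesis dc : differentiable c u.
Hypothesis c_sym : \forall v \near u, (c v)^T = c v.
Hypothesis c_unit : c u \in unitmx.

Lemma derive_lin (W : normedModType R) (f : V -> W) a X Y : differentiable f u ->
  'D_(a *: X + Y) f u = a *: 'D_X f u + 'D_Y f u.
Proof. by move=> df; rewrite derive_dirD// derive_dirZ. Qed.

Lemma derive_conformal_sym X : ('D_X c u)^T = 'D_X c u.
Proof. by rewrite -derive_trmx//; exact: near_eq_derive. Qed.

Lemma derive_ip_cst X Y Z : 'D_X (fun v => ip (c v) Y Z) u = ip ('D_X c u) Y Z.
Proof.
apply: etrans (derive_ip X dc (differentiable_cst Y u) (differentiable_cst Z u)) _.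
by rewrite !derive_cst ip0l ip0r add0r addr0.
Qed.

Lemma koszulE X Y Z :
  koszul c th u X Y Z = koszul_form (fun X => 'D_X c u) (c u) (th u) X Y Z.
Proof.
rewrite /koszul /cov_density.
rewrite (derive_ip_cst X Y Z) (derive_ip_cst Y X Z) (derive_ip_cst Z X Y).
rewrite /koszul_form; move: ('D_X c u) ('D_Y c u) ('D_Z c u) => A1 A2 A3; by field.
Qed.

Lemma ip_christoffel X Y Z :
  ip (c u) (christoffel c th u X Y) Z = koszul_form (fun X => 'D_X c u) (c u) (th u) X Y Z.
Proof.
rewrite /ip /christoffel mulmxKV//.
rewrite (linear_formE (f := koszul_form (fun X => 'D_X c u) (c u) (th u) X Y)); last first.
  by move=> a Z1 Z2; apply: koszul_form_linr => b X1 X2; exact: derive_lin.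
rewrite mxE; apply: eq_bigr => k _; rewrite !mxE koszulE mulrC.
by [].
Qed.

Lemma ip_cov w X (Y : V -> V) Z : ip (c u) (cov c th w X Y u) Z =
  ip (c u) ('D_X Y u) Z + koszul_form (fun X => 'D_X c u) (c u) (th u) X (Y u) Z
  + w * pairing (th u) X * ip (c u) (Y u) Z.
Proof. by rewrite /cov !ipDl ip_christoffel ipZl. Qed.

End Koszul.

(** * Covariant derivatives under conformal projections *)
Section JacobianDerivative.
Context {R : realType} {n k : nat}.
Variables (U : set 'rV[R]_n) (f : 'rV[R]_n -> 'rV[R]_k).
Hypotheses (openU : open U) (f_smooth : smooth_on U f).

Lemma mul_jacobian v X : X *m 'J f v = 'd f v X.
Proof. by rewrite mul_rV_lin1. Qed.

Lemma jacobian_derive v X : U v -> X *m 'J f v = 'D_X f v.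
Proof. by move=> Uv; rewrite mul_jacobian deriveE//; exact: smooth_on_differentiable f_smooth Uv. Qed.

Lemma differentiable_jacobian u : U u -> differentiable (jacobian f) u.
Proof.
move=> Uu; apply/differentiable_mxP => i j.
have /differentiable_mxP d : differentiable ('D_(delta_mx 0 i) f) u.
  by apply: smooth_on_differentiable Uu; exact: smooth_on_derive.
apply: near_eq_differentiable (d 0 j).
apply: eq_on_near Uu => // v Uv.
by rewrite -jacobian_derive// -rowE mxE.
Qed.

Lemma derive_jacobian u X Y : U u -> Y *m 'D_X (jacobian f) u = 'D_X ('D_Y f) u.
Proof.
move=> Uu; have dJ := differentiable_jacobian Uu.
have -> : 'D_X ('D_Y f) u = 'D_X (fun v => Y *m 'J f v) u.
  apply: near_eq_derive; apply: eq_on_near Uu => // v Uv.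
  by rewrite jacobian_derive.
apply: esym; apply: etrans (derive_mulmx X (differentiable_cst Y u) dJ) _.
by rewrite derive_cst mul0mx add0r.
Qed.

Lemma derive_jacobian_sym u X Y : U u -> Y *m 'D_X (jacobian f) u = X *m 'D_Y (jacobian f) u.
Proof.
move=> Uu; apply: (etrans (derive_jacobian X Y Uu)).
apply: (etrans _ (esym (derive_jacobian Y X Uu))).
apply: derive_sym; first exact: smooth_on_near_differentiable f_smooth Uu.
- by apply: smooth_on_differentiable Uu; exact: smooth_on_derive.
- by apply: smooth_on_differentiable Uu; exact: smooth_on_derive.
Qed.

End JacobianDerivative.

(** [f] multiplies the degenerate metric [c - eta (x) eta] by [m^2]; vectors in
    the kernel of [eta] are called horizontal. *)
Section ConformalPullback.
Context {R : realType} {n k : nat}.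
Implicit Types X Y Z : 'rV[R]_n.
Variables (U : set 'rV[R]_n) (f : 'rV[R]_n -> 'rV[R]_k).
Variables (c : 'rV[R]_n -> 'M[R]_n) (cB : 'rV[R]_k -> 'M[R]_k).
Variables (eta : 'rV[R]_n -> 'rV[R]_n) (m : 'rV[R]_n -> R).
Hypotheses (openU : open U) (f_smooth : smooth_on U f).
Hypothesis m_gt0 : forall v, U v -> 0 < m v.

Let horizontal_form v X Y := ip (c v) X Y - pairing (eta v) X * pairing (eta v) Y.

Hypothesis conf : forall v X Y, U v ->
  ip (cB (f v)) ('d f v X) ('d f v Y) = m v ^+ 2 * horizontal_form v X Y.

Variable u : 'rV[R]_n.
Hypothesis Uu : U u.
Hypothesis dc : differentiable c u.
Hypothesis dcB : differentiable cB (f u).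
Hypothesis deta : differentiable eta u.

Let df : differentiable f u := smooth_on_differentiable f_smooth Uu.
Let dJ : differentiable (jacobian f) u := differentiable_jacobian openU f_smooth Uu.

Let dcBf : differentiable (fun v => cB (f v)) u := differentiable_comp df dcB.

Let dJX X : differentiable (fun v => X *m 'J f v) u.
Proof. exact: differentiable_mulmx. Qed.

Let dpairing X : differentiable (fun v => pairing (eta v) X) u.
Proof.
apply: (differentiable_mxP (fun v => X *m (eta v)^T) u).1.
by apply: differentiable_mulmx => //; exact: differentiable_trmx.
Qed.

Let dhor X Y : differentiable (fun v => horizontal_form v X Y) u.
Proof.
apply: differentiableB; first exact: differentiable_ip.
exact: differentiableM.
Qed.

(** By [conf], [m] is the square root of a quotient of differentiable functions. *)
Lemma differentiable_factor X : horizontal_form u X X != 0 -> differentiable m u.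
Proof.
move=> nz.
pose q v := ip (cB (f v)) (X *m 'J f v) (X *m 'J f v) * (horizontal_form v X X)^-1.
have dq : differentiable q u.
  apply: differentiableM; first exact: differentiable_ip.
  exact: differentiableV.
have nz_near : \forall v \near u, horizontal_form v X X != 0.
  have /differentiable_continuous ch := dhor X X.
  exact: (ch _ (open_nbhs_nbhs (conj (@open_neq R 0) nz))).
have qm : \forall v \near u, Num.sqrt (q v) = m v.
  apply: filterS2 nz_near (open_nbhs_nbhs (conj openU Uu)) => v hv Uv.
  by rewrite /q !mul_jacobian conf// mulfK// sqrtr_sqr gtr0_norm// m_gt0.
have q0 : 0 < q u.
  by rewrite /q !mul_jacobian conf// mulfK// exprn_gt0// m_gt0.
apply: near_eq_differentiable qm _.
apply: (differentiable_comp dq).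
by apply/derivable1_diffP; have [] := is_derive1_sqrt q0.
Qed.

Hypothesis dm : differentiable m u.

Let horizontal X := pairing (eta u) X = 0.

(** The derivative of [eta (x) eta] vanishes on horizontal vectors, each of its
    terms retaining a factor [eta]. *)
Lemma derive_conf X Y Z : horizontal Y -> horizontal Z ->
  ip (cB (f u)) (Y *m 'D_X (jacobian f) u) (Z *m 'J f u)
  + ip ('D_(X *m 'J f u) cB (f u)) (Y *m 'J f u) (Z *m 'J f u)
  + ip (cB (f u)) (Y *m 'J f u) (Z *m 'D_X (jacobian f) u)
  = 2 * m u * 'D_X m u * ip (c u) Y Z + m u ^+ 2 * ip ('D_X c u) Y Z.
Proof.
move=> hY hZ.
have DJ W : 'D_X (fun v => W *m 'J f v) u = W *m 'D_X (jacobian f) u.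
  apply: etrans (derive_mulmx X (differentiable_cst W u) dJ) _.
  by rewrite derive_cst mul0mx add0r.
have DcB : 'D_X (fun v => cB (f v)) u = 'D_(X *m 'J f u) cB (f u).
  by rewrite (jacobian_derive f_smooth X Uu); exact: (derive_comp X df dcB).
have := derive_ip X dcBf (dJX Y) (dJX Z); rewrite !DJ DcB => <-.
have -> : 'D_X (fun v => ip (cB (f v)) (Y *m 'J f v) (Z *m 'J f v)) u =
    'D_X (fun v => m v ^+ 2 * horizontal_form v Y Z) u.
  by apply: near_eq_derive; apply: eq_on_near Uu => // v Uv; rewrite !mul_jacobian conf.
have Dm2 : is_derive u X (fun v => m v ^+ 2) (2 * m u * 'D_X m u).
  have dmX : is_derive u X m ('D_X m u) by exact/derivableP/diff_derivable.
  have -> : (fun v => m v ^+ 2) = m * m by apply/funext => v; rewrite expr2.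
  apply: (is_derive_eq (is_deriveM dmX dmX)).
  by rewrite /GRing.scale/= -mulrDl -mulr2n mulr_natl.
have dpX W : is_derive u X (fun v => pairing (eta v) W) ('D_X (fun v => pairing (eta v) W) u).
  exact/derivableP/diff_derivable.
have dhX : is_derive u X (fun v => horizontal_form v Y Z) (ip ('D_X c u) Y Z).
  have dipX : is_derive u X (fun v => ip (c v) Y Z) (ip ('D_X c u) Y Z).
    rewrite -derive_ip_cst//; apply/derivableP/diff_derivable.
    exact: differentiable_ip.
  apply: (is_derive_eq (is_deriveB dipX (is_deriveM (dpX Y) (dpX Z)))).
  by rewrite hY hZ !scale0r addr0 subr0.
have -> := derive_val (is_derive := is_deriveM Dm2 dhX).
rewrite /horizontal_form hY mul0r subr0 /GRing.scale/= addrC; congr (_ + _).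
exact: mulrC.
Qed.



Variables (th : 'rV[R]_n -> 'rV[R]_n) (thB : 'rV[R]_k -> 'rV[R]_k).
Hypothesis weyl : weyl_pullback_at f m th thB u.

(** It suffices to pull back the constant section [1] of [L]. *)
Lemma weyl_pullback_form X :
  pairing (th u) X = pairing (thB (f u)) ('d f u X) + 'D_X m u / m u.
Proof.
have m0 : m u != 0 by rewrite gt_eqF// m_gt0.
have := weyl X (differentiable_cst (1 : R) (f u)).
rewrite /cov_density derive_cst add0r !mul1r mulr1.
have -> : (fun v => (m v)^-1 * 1) = (fun v => (m v)^-1).
  by apply/funext => v; rewrite mulr1.
have -> : 'D_X (fun v => (m v)^-1) u = - (m u) ^- 2 * 'D_X m u.
  by apply: deriveV => //; exact: diff_derivable.
rewrite mulr1; move: ('D_X m u) (pairing (th u) X) (pairing (thB (f u)) _) => a b d E.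
have -> : b = m u * (b / m u) by field.
have -> : b / m u = (m u)^-1 * d + (m u) ^- 2 * a by rewrite -E; ring.
by field.
Qed.

Hypothesis cB_sym : \forall w \near f u, (cB w)^T = cB w.

Let koszul_scalars (m0 mx my mz Cyz Cxz Cxy a1 a2 a3 b1 b2 b3 sx sy sz gz gy gx : R) :
  m0 != 0 ->
  gz + b1 + gy = 2 * m0 * mx * Cyz + m0 ^+ 2 * a1 ->
  gz + b2 + gx = 2 * m0 * my * Cxz + m0 ^+ 2 * a2 ->
  gy + b3 + gx = 2 * m0 * mz * Cxy + m0 ^+ 2 * a3 ->
  m0 ^+ 2 * (2^-1 * (a1 + a2 - a3) + (sx + mx / m0) * Cyz + (sy + my / m0) * Cxz
    - (sz + mz / m0) * Cxy) =
  2^-1 * (b1 + b2 - b3) + sx * (m0 ^+ 2 * Cyz) + sy * (m0 ^+ 2 * Cxz)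
    - sz * (m0 ^+ 2 * Cxy) + gz.
Proof.
move=> nz E1 E2 E3.
have -> : b1 = 2 * m0 * mx * Cyz + m0 ^+ 2 * a1 - gz - gy by rewrite -E1; ring.
have -> : b2 = 2 * m0 * my * Cxz + m0 ^+ 2 * a2 - gz - gx by rewrite -E2; ring.
have -> : b3 = 2 * m0 * mz * Cxy + m0 ^+ 2 * a3 - gy - gx by rewrite -E3; ring.
by field.
Qed.

(** In the alternating sum of [derive_conf] over the three arguments, as in the
    Koszul formula, the symmetric second derivatives of [f] cancel except for
    twice the one in the first two arguments.  The derivatives of [m] are
    absorbed by [weyl_pullback_form]. *)
Lemma koszul_form_pullback X Y Z : horizontal X -> horizontal Y -> horizontal Z ->
  m u ^+ 2 * koszul_form (fun W => 'D_W c u) (c u) (th u) X Y Z =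
  koszul_form (fun W => 'D_W cB (f u)) (cB (f u)) (thB (f u))
    ('d f u X) ('d f u Y) ('d f u Z)
  + ip (cB (f u)) (Y *m 'D_X (jacobian f) u) ('d f u Z).
Proof.
move=> hX hY hZ.
have gC V W : ip (cB (f u)) V W = ip (cB (f u)) W V := ip_sym V W (nbhs_singleton cB_sym).
(* [S] and [T] stand for the derivatives of the Jacobian and of [cB]. *)
have [S SE] : exists S : 'rV[R]_n -> 'M[R]_(n, k), forall W, 'D_W (jacobian f) u = S W.
  by exists (fun W => 'D_W (jacobian f) u).
have [T TE] : exists T : 'rV[R]_k -> 'M[R]_k, forall W, 'D_W cB (f u) = T W.
  by exists (fun W => 'D_W cB (f u)).
have S_sym V W : W *m S V = V *m S W.
  by rewrite -!SE; exact: (derive_jacobian_sym openU f_smooth).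
have E V W W' (hW : horizontal W) (hW' : horizontal W') := derive_conf V hW hW'.
rewrite /koszul_form !weyl_pullback_form !conf//.
rewrite /horizontal_form hX hY mul0r mulr0 !subr0 SE !TE.
apply: (@koszul_scalars _ _ _ _ _ _ _ _ _ _ _ _ _ _ _ _ _
  (ip (cB (f u)) (Z *m S X) ('d f u Y)) (ip (cB (f u)) (Z *m S Y) ('d f u X))).
- by rewrite gt_eqF// m_gt0.
- rewrite -(E X Y Z hY hZ) SE TE !mul_jacobian; congr (_ + _).
  exact: gC.
- rewrite -(E Y X Z hX hZ) SE TE !mul_jacobian S_sym; congr (_ + _).
  exact: gC.
- rewrite -(E Z X Y hX hY) SE TE !mul_jacobian (S_sym X Z) (S_sym Y Z); congr (_ + _).
  exact: gC.
Qed.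

Hypotheses (c_unit : c u \in unitmx) (cB_unit : cB (f u) \in unitmx).
Variables (Y : 'rV[R]_n -> 'rV[R]_n) (YB : 'rV[R]_k -> 'rV[R]_k).
Hypotheses (dY : differentiable Y u) (dYB : differentiable YB (f u)).
Hypothesis projectable : forall v, U v -> 'd f v (Y v) = m v *: YB (f v).

Let cov_scalars (m0 mx gyB kYB kX kYB' px pB gYB cY cy gYS : R) :
  m0 != 0 ->
  gYB = m0 * cY ->
  m0 ^+ 2 * cy + gYS = mx * (m0 * cY) + m0 * gyB ->
  m0 * kYB = kYB' ->
  m0 ^+ 2 * kX = kYB' + gYS ->
  px = pB + mx / m0 ->
  gyB + kYB + -1 * pB * gYB = m0 * (cy + kX + -1 * px * cY).
Proof.
move=> nz -> E1 E2 E3 ->; apply: (mulfI nz).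
have -> : m0 * (gyB + kYB + -1 * pB * (m0 * cY)) =
  m0 * gyB + m0 * kYB - pB * m0 ^+ 2 * cY by ring.
have -> : m0 * gyB = m0 ^+ 2 * cy + gYS - mx * (m0 * cY) by rewrite E1; ring.
have -> : m0 * kYB = m0 ^+ 2 * kX - gYS by rewrite E2 E3; ring.
by field.
Qed.

(** Differentiating [projectable] produces the second derivative of [f] that
    [koszul_form_pullback] leaves over, and a derivative of [m] that matches the
    one in [weyl_pullback_form], since [Y] and [YB] have weight [-1]. *)
Lemma ip_cov_pullback X Z : horizontal X -> horizontal (Y u) -> horizontal Z ->
  ip (cB (f u)) (cov cB thB (-1) ('d f u X) YB (f u)) ('d f u Z) =
  m u * ip (c u) (cov c th (-1) X Y u) Z.
Proof.
move=> hX hY hZ; have m0 : m u != 0 by rewrite gt_eqF// m_gt0.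
have dYf : 'D_X Y u *m 'J f u + Y u *m 'D_X (jacobian f) u =
    'D_X m u *: YB (f u) + m u *: 'D_('d f u X) YB (f u).
  apply: etrans (esym (derive_mulmx X dY dJ)) _.
  have -> : 'D_X (fun v => Y v *m 'J f v) u = 'D_X (fun v => (m v)%:M *m YB (f v)) u.
    apply: near_eq_derive; apply: eq_on_near Uu => // v Uv.
    by rewrite mul_jacobian projectable// mul_scalar_mx.
  have dmM : differentiable (fun v => (m v)%:M : 'M[R]_1) u.
    apply/differentiable_mxP => i j; rewrite [i]ord1 [j]ord1.
    by under eq_fun do rewrite mxE.
  have dYBf : differentiable (fun v => YB (f v)) u := differentiable_comp df dYB.
  have Dm : 'D_X (fun v => (m v)%:M : 'M[R]_1) u = ('D_X m u)%:M.
    apply/matrixP => i j; rewrite [i]ord1 [j]ord1 -derive_entry// mxE.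
    by under eq_fun do rewrite mxE.
  have DYB : 'D_X (fun v => YB (f v)) u = 'D_('d f u X) YB (f u).
    by rewrite -(deriveE X df); exact: (derive_comp X df dYB).
  apply: etrans (derive_mulmx X dmM dYBf) _.
  apply: (etrans (f_equal2 (fun A B => A *m YB (f u) + (m u)%:M *m B) Dm DYB)).
  by rewrite !mul_scalar_mx.
have YBE : YB (f u) = (m u)^-1 *: 'd f u (Y u).
  by rewrite projectable// scalerA mulVf// scale1r.
apply: etrans (ip_cov thB dcB cB_unit (-1) ('d f u X) YB ('d f u Z)) _.
apply: (etrans _ (esym (congr1 ( *%R (m u)) (ip_cov th dc c_unit (-1) X Y Z)))).
have GYB : ip (cB (f u)) (YB (f u)) ('d f u Z) = m u * ip (c u) (Y u) Z.
  by rewrite YBE ipZl conf// /horizontal_form hZ mulr0 subr0 expr2 -mulrA mulKf.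
have Gy : ip (cB (f u)) ('D_X Y u *m 'J f u) ('d f u Z) = m u ^+ 2 * ip (c u) ('D_X Y u) Z.
  by rewrite mul_jacobian conf// /horizontal_form hZ mulr0 subr0.
have GdY := congr1 (fun W => ip (cB (f u)) W ('d f u Z)) dYf.
rewrite !ipDl !ipZl Gy GYB in GdY.
have KYB : m u * koszul_form (fun W => 'D_W cB (f u)) (cB (f u)) (thB (f u))
      ('d f u X) (YB (f u)) ('d f u Z) =
    koszul_form (fun W => 'D_W cB (f u)) (cB (f u)) (thB (f u))
      ('d f u X) ('d f u (Y u)) ('d f u Z).
  by rewrite projectable// koszul_formZm// => a V W; exact: derive_lin.
apply: cov_scalars m0 GYB GdY KYB (koszul_form_pullback hX hY hZ) (weyl_pullback_form X).
Qed.

End ConformalPullback.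

(** * Volume forms and orthonormal frames *)
Section Volume.
Context {R : realType}.

Lemma vol_linear n (v w w' : n.-tuple 'rV[R]_n) k a :
  tnth v k = a *: tnth w k + tnth w' k ->
  (forall i, i != k -> tnth w i = tnth v i /\ tnth w' i = tnth v i) ->
  vol v = a * vol w + vol w'.
Proof.
move=> vk vi; rewrite /vol -[X in _ + X]mul1r.
apply: (@determinant_multilinear _ _ _ _ _ k).
- by apply/rowP => j; rewrite !mxE vk !mxE mul1r.
- by apply/matrixP => i j; rewrite !mxE (vi (lift k i) _).1// eq_sym neq_lift.
- by apply/matrixP => i j; rewrite !mxE (vi (lift k i) _).2// eq_sym neq_lift.
Qed.

Lemma vol_alternate n (v : n.-tuple 'rV[R]_n) k l :
  k != l -> tnth v k = tnth v l -> vol v = 0.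
Proof.
by move=> kl vkl; apply: (determinant_alternate kl) => j; rewrite !mxE vkl.
Qed.

Lemma vol_mulmx n (v : n.-tuple 'rV[R]_n) (A : 'M[R]_n) :
  vol [tuple of map (mulmx^~ A) v] = vol v * \det A.
Proof.
rewrite /vol -det_mulmx; congr (\det _); apply/matrixP => i j.
rewrite !mxE tnth_map mxE; apply: eq_bigr => k _; by rewrite mxE.
Qed.

Lemma alternating_swap (V : lmodType R) (f : V -> V -> R) :
  (forall a X X' Y, f (a *: X + X') Y = a * f X Y + f X' Y) ->
  (forall a X Y Y', f X (a *: Y + Y') = a * f X Y + f X Y') ->
  (forall X, f X X = 0) -> forall X Y, f X Y = - f Y X.
Proof.
move=> fl fr f0 X Y; apply/eqP; rewrite -addr_eq0.
have := f0 (1 *: X + Y); rewrite fl !fr !f0 !mul1r !addr0 add0r.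
by move->.
Qed.

Section Dimension4.
Implicit Types X Y Z W : 'rV[R]_4.

Local Ltac vol4 k := (apply: (@vol_linear _ _ _ _ (@Ordinal 4 k isT)) =>
  [|[[|[|[|[|?]]]] ?] //]; by rewrite !(tnth_nth 0)).

Lemma vol4_lin1 Y Z W a X X' : vol [tuple a *: X + X'; Y; Z; W] =
  a * vol [tuple X; Y; Z; W] + vol [tuple X'; Y; Z; W].
Proof. vol4 0%N. Qed.
Lemma vol4_lin2 X Z W a Y Y' : vol [tuple X; a *: Y + Y'; Z; W] =
  a * vol [tuple X; Y; Z; W] + vol [tuple X; Y'; Z; W].
Proof. vol4 1%N. Qed.
Lemma vol4_lin3 X Y W a Z Z' : vol [tuple X; Y; a *: Z + Z'; W] =
  a * vol [tuple X; Y; Z; W] + vol [tuple X; Y; Z'; W].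
Proof. vol4 2%N. Qed.
Lemma vol4_lin4 X Y Z a W W' : vol [tuple X; Y; Z; a *: W + W'] =
  a * vol [tuple X; Y; Z; W] + vol [tuple X; Y; Z; W'].
Proof. vol4 3%N. Qed.

Local Ltac alt4 k l := by apply: (@vol_alternate _ _ (@Ordinal 4 k isT) (@Ordinal 4 l isT)).

Lemma vol4_alt12 X Y Z : vol [tuple X; X; Y; Z] = 0. Proof. alt4 0%N 1%N. Qed.
Lemma vol4_alt13 X Y Z : vol [tuple X; Y; X; Z] = 0. Proof. alt4 0%N 2%N. Qed.
Lemma vol4_alt14 X Y Z : vol [tuple X; Y; Z; X] = 0. Proof. alt4 0%N 3%N. Qed.
Lemma vol4_alt23 X Y Z : vol [tuple Y; X; X; Z] = 0. Proof. alt4 1%N 2%N. Qed.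
Lemma vol4_alt24 X Y Z : vol [tuple Y; X; Z; X] = 0. Proof. alt4 1%N 3%N. Qed.
Lemma vol4_alt34 X Y Z : vol [tuple Y; Z; X; X] = 0. Proof. alt4 2%N 3%N. Qed.

Lemma vol4_swap12 X Y Z W : vol [tuple X; Y; Z; W] = - vol [tuple Y; X; Z; W].
Proof.
apply: (alternating_swap (f := fun X Y => vol [tuple X; Y; Z; W])) => *;
  [exact: vol4_lin1|exact: vol4_lin2|exact: vol4_alt12].
Qed.
Lemma vol4_swap23 X Y Z W : vol [tuple X; Y; Z; W] = - vol [tuple X; Z; Y; W].
Proof.
apply: (alternating_swap (f := fun Y Z => vol [tuple X; Y; Z; W])) => *;
  [exact: vol4_lin2|exact: vol4_lin3|exact: vol4_alt23].
Qed.
Lemma vol4_swap34 X Y Z W : vol [tuple X; Y; Z; W] = - vol [tuple X; Y; W; Z].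
Proof.
apply: (alternating_swap (f := fun Z W => vol [tuple X; Y; Z; W])) => *;
  [exact: vol4_lin3|exact: vol4_lin4|exact: vol4_alt34].
Qed.

End Dimension4.

Section Dimension3.
Implicit Types X Y Z : 'rV[R]_3.

Local Ltac vol3 k := (apply: (@vol_linear _ _ _ _ (@Ordinal 3 k isT)) =>
  [|[[|[|[|?]]] ?] //]; by rewrite !(tnth_nth 0)).

Lemma vol3_lin1 Y Z a X X' : vol [tuple a *: X + X'; Y; Z] =
  a * vol [tuple X; Y; Z] + vol [tuple X'; Y; Z].
Proof. vol3 0%N. Qed.
Lemma vol3_lin2 X Z a Y Y' : vol [tuple X; a *: Y + Y'; Z] =
  a * vol [tuple X; Y; Z] + vol [tuple X; Y'; Z].
Proof. vol3 1%N. Qed.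
Lemma vol3_lin3 X Y a Z Z' : vol [tuple X; Y; a *: Z + Z'] =
  a * vol [tuple X; Y; Z] + vol [tuple X; Y; Z'].
Proof. vol3 2%N. Qed.
Lemma vol3_alt23 X Y : vol [tuple X; Y; Y] = 0.
Proof. by apply: (@vol_alternate _ _ (@Ordinal 3 1 isT) (@Ordinal 3 2 isT)). Qed.
Lemma vol3_swap23 X Y Z : vol [tuple X; Y; Z] = - vol [tuple X; Z; Y].
Proof.
apply: (alternating_swap (f := fun Y Z => vol [tuple X; Y; Z])) => *;
  [exact: vol3_lin2|exact: vol3_lin3|exact: vol3_alt23].
Qed.
Lemma vol3_mulmx X Y Z A : vol [tuple X *m A; Y *m A; Z *m A] = vol [tuple X; Y; Z] * \det A.
Proof. by rewrite -vol_mulmx; congr vol; apply/val_inj. Qed.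

Lemma ip_star1 X Y Z : ip (star1 X) Y Z = vol [tuple X; Y; Z].
Proof.
rewrite [RHS](linear_formE (f := fun Y => vol [tuple X; Y; Z])); last first.
  by move=> a Y1 Y2; exact: vol3_lin2.
rewrite [LHS](linear_formE (f := fun Y => ip (star1 X) Y Z)); last first.
  by move=> a Y1 Y2; rewrite ipDl ipZl.
apply: eq_bigr => k _; congr (_ * _).
rewrite [RHS](linear_formE (f := fun Z => vol [tuple X; _; Z])); last first.
  by move=> a Y1 Y2; exact: vol3_lin3.
rewrite [LHS](linear_formE (f := fun Z => ip (star1 X) _ Z)); last first.
  by move=> a Y1 Y2; rewrite ipDr ipZr.
by apply: eq_bigr => l _; rewrite ip_delta mxE.
Qed.

End Dimension3.
End Volume.

Section Star2.
Context {R : realType}.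
Implicit Types (X Y : 'rV[R]_4) (F C : 'M[R]_4).

Lemma ip_star2 C F X Y : ip (star2 C F) X Y =
  2^-1 * \sum_a \sum_b (invmx C *m F *m invmx C) a b *
    vol [tuple delta_mx 0 b; delta_mx 0 a; X; Y].
Proof.
pose s X Y := 2^-1 * \sum_a \sum_b (invmx C *m F *m invmx C) a b *
    vol [tuple delta_mx 0 b; delta_mx 0 a; X; Y].
have sl a X1 X2 Z : s (a *: X1 + X2) Z = a * s X1 Z + s X2 Z.
  rewrite /s mulrCA -mulrDr; congr (_ * _); rewrite mulr_sumr -big_split.
  apply: eq_bigr => i _; rewrite /= mulr_sumr -big_split; apply: eq_bigr => j _ /=.
  by rewrite vol4_lin3 mulrDr mulrCA.
have sr a X1 X2 Z : s Z (a *: X1 + X2) = a * s Z X1 + s Z X2.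
  rewrite /s mulrCA -mulrDr; congr (_ * _); rewrite mulr_sumr -big_split.
  apply: eq_bigr => i _; rewrite /= mulr_sumr -big_split; apply: eq_bigr => j _ /=.
  by rewrite vol4_lin4 mulrDr mulrCA.
rewrite -[RHS]/(s X Y) [RHS](linear_formE (f := fun X => s X Y)); last by move=> *; exact: sl.
rewrite [LHS](linear_formE (f := fun X => ip (star2 C F) X Y)); last first.
  by move=> *; rewrite ipDl ipZl.
apply: eq_bigr => i _; congr (_ * _).
rewrite [RHS](linear_formE (f := fun X => s _ X)); last by move=> *; exact: sr.
rewrite [LHS](linear_formE (f := fun X => ip (star2 C F) _ X)); last first.
  by move=> *; rewrite ipDr ipZr.
by apply: eq_bigr => j _; rewrite ip_delta mxE.
Qed.

Variables (C E : 'M[R]_4).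
Hypothesis orthonormal : E *m C *m E^T = 1%:M.

Lemma invmx_frame : invmx C = E^T *m E.
Proof.
have E1 : C *m E^T *m E = 1%:M by apply: mulmx1C; rewrite mulmxA.
have uC : C \in unitmx by case: (mulmx1_unit (etrans (mulmxA _ _ _) E1)).
by apply: (can_inj (mulKmx uC)); rewrite mulmxV// mulmxA.
Qed.

Lemma vol4_sum12 (x y : 'I_4 -> R) X Y :
  \sum_a \sum_b x a * y b * vol [tuple delta_mx 0 b; delta_mx 0 a; X; Y] =
  vol [tuple \row_b y b; \row_a x a; X; Y].
Proof.
rewrite [RHS](linear_formE (f := fun Z => vol [tuple _; Z; X; Y])); last first.
  by move=> *; exact: vol4_lin2.
apply: eq_bigr => a _; rewrite mxE.
rewrite [in RHS](linear_formE (f := fun Z => vol [tuple Z; _; X; Y])); last first.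
  by move=> *; exact: vol4_lin1.
by rewrite mulr_sumr; apply: eq_bigr => b _; rewrite mxE mulrA.
Qed.

(** Contraction with the inverse of [C] may be computed in any [C]-orthonormal
    basis. *)
Lemma ip_star2_frame F X Y : ip (star2 C F) X Y =
  2^-1 * \sum_i \sum_j ip F (row i E) (row j E) * vol [tuple row j E; row i E; X; Y].
Proof.
rewrite ip_star2; congr (_ * _); rewrite invmx_frame.
transitivity (\sum_a \sum_b \sum_i \sum_j ip F (row i E) (row j E) *
    (E i a * E j b * vol [tuple delta_mx 0 b; delta_mx 0 a; X; Y])).
  apply: eq_bigr => a _; apply: eq_bigr => b _.
  have -> : (E^T *m E *m F *m (E^T *m E)) a b =
      \sum_i \sum_j ip F (row i E) (row j E) * (E i a * E j b).
    have -> : E^T *m E *m F *m (E^T *m E) = E^T *m (E *m F *m E^T) *m E.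
      by rewrite !mulmxA.
    rewrite mxE; under eq_bigr do rewrite mxE mulr_suml.
    rewrite [LHS]exchange_big /=. apply: eq_bigr => i _. apply: eq_bigr => j _.
    rewrite mxE mulrAC mulrC /ip; congr (_ * _).
    rewrite -row_mul [LHS]mxE [RHS]mxE; apply: eq_bigr => l _.
    by congr (_ * _); rewrite !mxE.
  rewrite mulr_suml; apply: eq_bigr => i _; rewrite mulr_suml; apply: eq_bigr => j _.
  exact/esym/mulrA.
transitivity (\sum_i \sum_j \sum_a \sum_b ip F (row i E) (row j E) *
    (E i a * E j b * vol [tuple delta_mx 0 b; delta_mx 0 a; X; Y])).
  under eq_bigr do rewrite exchange_big /=.
  rewrite [LHS]exchange_big /=. apply: eq_bigr => i _.
  under eq_bigr do rewrite exchange_big /=.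
  by rewrite exchange_big.
apply: eq_bigr => i _; apply: eq_bigr => j _.
under eq_bigr do rewrite -mulr_sumr.
rewrite -mulr_sumr vol4_sum12; congr (_ * vol _).
Qed.

End Star2.

Section Frame.
Context {R : realType}.
Implicit Types (X Y : 'rV[R]_4).
Variables (C : 'M[R]_4) (e0 e1 e2 e3 : 'rV[R]_4).
Let E : 'M[R]_4 := \matrix_i tnth [tuple e0; e1; e2; e3] i.
Hypothesis orthonormal : E *m C *m E^T = 1%:M.

Lemma frame_expand X : X = ip C X e0 *: e0 + ip C X e1 *: e1 + ip C X e2 *: e2 + ip C X e3 *: e3.
Proof.
have E1 : C *m E^T *m E = 1%:M by apply: mulmx1C; rewrite mulmxA.
have coef i : (X *m C *m E^T) 0 i = ip C X (tnth [tuple e0; e1; e2; e3] i).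
  by rewrite /ip mxE [RHS]mxE; apply: eq_bigr => k _; rewrite !mxE.
rewrite -{1}[X]mulmx1 -E1 !mulmxA mulmx_sum_row !big_ord_recl big_ord0 addr0 !addrA.
by rewrite !rowK !coef !(tnth_nth 0).
Qed.

(** In the double sum of [ip_star2_frame] only the two terms in which [vol] has
    four distinct arguments survive. The minus sign reflects the order of the
    arguments in the definition of the star operator. *)
Lemma star2_frame F : (forall X Y, ip F X Y = - ip F Y X) ->
  let v := vol [tuple e0; e1; e2; e3] in
  [/\ ip (star2 C F) e0 e1 = - ip F e2 e3 * v, ip (star2 C F) e0 e2 = - ip F e3 e1 * v &
      ip (star2 C F) e0 e3 = - ip F e1 e2 * v].
Proof.
move=> skF v.
have rot X Y Z W : vol [tuple X; Y; Z; W] = vol [tuple Z; W; X; Y].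
  by rewrite vol4_swap23 vol4_swap12 opprK vol4_swap34 vol4_swap23 opprK.
have cyc X Y Z W : vol [tuple X; Y; Z; W] = vol [tuple X; Z; W; Y].
  by rewrite vol4_swap23 vol4_swap34 opprK.
split; rewrite (ip_star2_frame orthonormal) !big_ord_recl !big_ord0 !rowK.
- rewrite !(tnth_nth 0) /= !(vol4_alt12, vol4_alt13, vol4_alt14, vol4_alt23, vol4_alt24, vol4_alt34).
  rewrite [vol [tuple e3; _; _; _]]rot (vol4_swap34 e0 e1) [vol [tuple e2; _; _; _]]rot.
  by rewrite (skF e3 e2) -/v; field.
- rewrite !(tnth_nth 0) /= !(vol4_alt12, vol4_alt13, vol4_alt14, vol4_alt23, vol4_alt24, vol4_alt34).
  rewrite [vol [tuple e1; _; _; _]]rot [vol [tuple e3; _; _; _]]rot (vol4_swap34 e0 e2 e1).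
  by rewrite -(cyc e0 e1 e2 e3) (skF e1 e3) -/v; field.
- rewrite !(tnth_nth 0) /= !(vol4_alt12, vol4_alt13, vol4_alt14, vol4_alt23, vol4_alt24, vol4_alt34).
  rewrite [vol [tuple e1; _; _; _]]rot [vol [tuple e2; _; _; _]]rot (vol4_swap34 e0 e3 e2).
  by rewrite -(cyc e0 e2 e3 e1) -(cyc e0 e1 e2 e3) (skF e2 e1) -/v; field.
Qed.

End Frame.

(** * The first jet of an invariant complex structure *)

(** The components at one point of a conformal structure, an almost complex
    structure and a congruence, together with their derivatives [dC X], [dJ X],
    [dxi X] in the direction [X]; [t] is the 1-form of [D^0]. *)
Section Jet.
Context {R : realType}.
Implicit Types X Y Z : 'rV[R]_4.
Variables (C : 'M[R]_4) (dC : 'rV[R]_4 -> 'M[R]_4) (t : 'rV[R]_4).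
Variables (J : 'M[R]_4) (dJ : 'rV[R]_4 -> 'M[R]_4).
Variables (xi : 'rV[R]_4) (dxi : 'rV[R]_4 -> 'rV[R]_4).

(** [<(D_X J) Y, Z>], using that [J] is skew *)
Definition nabla_J t X Y Z : R := ip C (Y *m dJ X) Z
  + koszul_form dC C t X (Y *m J) Z + koszul_form dC C t X Y (Z *m J).

(** [<D_X xi, Z>], with [xi] of weight [-1] *)
Definition nabla_xi X Z : R := ip C (dxi X) Z
  + koszul_form dC C t X xi Z - pairing t X * ip C xi Z.

Hypothesis C_sym : C^T = C.
Hypothesis dC_lin : forall a X Y, dC (a *: X + Y) = a *: dC X + dC Y.
Hypothesis dC_sym : forall X, (dC X)^T = dC X.
Hypothesis dJ_lin : forall a X Y, dJ (a *: X + Y) = a *: dJ X + dJ Y.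
Hypothesis dxi_lin : forall a X Y, dxi (a *: X + Y) = a *: dxi X + dxi Y.
Hypothesis J2 : J *m J = - 1%:M.
Hypothesis dJ2 : forall X, dJ X *m J + J *m dJ X = 0.
Hypothesis J_skew : forall X Y, ip C (X *m J) Y = - ip C X (Y *m J).
Hypothesis dJ_skew : forall X Y Z, ip C (Y *m dJ X) Z + ip C Y (Z *m dJ X)
  + ip (dC X) (Y *m J) Z + ip (dC X) Y (Z *m J) = 0.
Hypothesis xi_unit : ip C xi xi = 1.
Hypothesis dxi_unit : forall X, 2 * ip C (dxi X) xi + ip (dC X) xi xi = 0.

Let CC X Y : ip C X Y = ip C Y X. Proof. exact: ip_sym. Qed.
Let KC t' X Y Z : koszul_form dC C t' X Y Z = koszul_form dC C t' Y X Z.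
Proof. exact: koszul_formC. Qed.
Let JJ X : X *m J *m J = - X.
Proof. by rewrite -mulmxA J2 mulmxN mulmx1. Qed.

Lemma nabla_J_lin1 t' a X X' Y Z :
  nabla_J t' (a *: X + X') Y Z = a * nabla_J t' X Y Z + nabla_J t' X' Y Z.
Proof.
rewrite /nabla_J dJ_lin mulmxDr -scalemxAr ipDl ipZl !koszul_form_lin//; ring.
Qed.

Lemma nabla_J_lin3 t' a X Y Z Z' :
  nabla_J t' X Y (a *: Z + Z') = a * nabla_J t' X Y Z + nabla_J t' X Y Z'.
Proof.
rewrite /nabla_J mulmxDl -scalemxAl ipDr ipZr !koszul_form_linr//; ring.
Qed.

Lemma nabla_J_skew t' X Y Z : nabla_J t' X Y Z = - nabla_J t' X Z Y.
Proof.
apply/eqP; rewrite -addr_eq0 /nabla_J; apply/eqP.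
have E1 := koszul_form_metric t' C_sym dC_sym X (Y *m J) Z.
have E2 := koszul_form_metric t' C_sym dC_sym X Y (Z *m J).
have E3 := dJ_skew X Y Z; rewrite (CC Y) in E3.
rewrite (J_skew Y Z) in E1.
have key (a b k1 k2 k3 k4 i1 i2 p : R) : k1 + k2 = i1 + p * - b -> k3 + k4 = i2 + p * b ->
   forall a', a + a' + i1 + i2 = 0 -> a + k1 + k3 + (a' + k4 + k2) = 0.
  move=> e1 e2 a' e3; have -> : a + k1 + k3 + (a' + k4 + k2) = a + a' + (k1 + k2) + (k3 + k4) by ring.
  by rewrite e1 e2 -e3; ring.
exact: key E1 E2 _ E3.
Qed.

Lemma nabla_J_lin2 t' a X Y Y' Z :
  nabla_J t' X (a *: Y + Y') Z = a * nabla_J t' X Y Z + nabla_J t' X Y' Z.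
Proof.
by rewrite nabla_J_skew nabla_J_lin3 opprD -mulrN -!nabla_J_skew.
Qed.

(** [D_X J] anticommutes with [J], as [J] squares to [-1]; skewness of [J] moves
    the second factor to the other argument. *)
Lemma nabla_J_J t' X Y Z : nabla_J t' X (Y *m J) Z = nabla_J t' X Y (Z *m J).
Proof.
rewrite /nabla_J !JJ.
have E : ip C (Y *m J *m dJ X) Z = ip C (Y *m dJ X) (Z *m J).
  have -> : Y *m J *m dJ X = - (Y *m dJ X *m J).
    by apply/eqP; rewrite -addr_eq0 -!mulmxA -mulmxDr addrC dJ2 mulmx0.
  by rewrite ipNl J_skew opprK.
have KN1 A B : koszul_form dC C t' X (- A) B = - koszul_form dC C t' X A B.
  by rewrite -scaleN1r koszul_formZm// mulN1r.
have KN2 A B : koszul_form dC C t' X A (- B) = - koszul_form dC C t' X A B.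
  have := koszul_form_linr C t' dC_lin (-1) X A B B.
  rewrite scaleN1r addNr mulN1r addNr => K0.
  have := koszul_form_linr C t' dC_lin (-1) X A B 0.
  by rewrite scaleN1r addr0 mulN1r -(addNr B) -scaleN1r koszul_form_linr// mulN1r addNr addr0.
rewrite E KN1 KN2; ring.
Qed.

Lemma nabla_J_shift t' s X Y Z : nabla_J (t' + s) X Y Z = nabla_J t' X Y Z
  + pairing s (Y *m J) * ip C X Z - pairing s Z * ip C X (Y *m J)
  + pairing s Y * ip C X (Z *m J) - pairing s (Z *m J) * ip C X Y.
Proof. by rewrite /nabla_J !koszul_form_shift J_skew; ring. Qed.

Lemma nabla_xi_xi X : nabla_xi X xi = 0.
Proof.
have E1 := koszul_form_metric t C_sym dC_sym X xi xi.
have := dxi_unit X; rewrite /nabla_xi xi_unit.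
rewrite xi_unit in E1.
have key (a b k p : R) : k + k = b + 2 * p * 1 -> 2 * a + b = 0 -> a + k - p * 1 = 0 by lra.
exact: key E1.
Qed.

Hypothesis geodesic : forall Z, nabla_xi xi Z = 0.
Hypothesis invariant : forall Y, Y *m dJ xi - dxi (Y *m J) + dxi Y *m J
  + pairing t (Y *m J) *: xi - pairing t Y *: (xi *m J) = 0.

(** As [D] is torsion-free, the Weyl-Lie derivative of [J] along [xi] differs
    from [D_xi J] by the commutator of [D xi] and [J]. *)
Lemma nabla_J_invariant Y Z :
  nabla_J t xi Y Z = nabla_xi (Y *m J) Z + nabla_xi Y (Z *m J).
Proof.
have := congr1 (fun V => ip C V Z) (invariant Y).
rewrite !(ipDl, ipNl, ipZl) ip0l !J_skew.
rewrite /nabla_J /nabla_xi (KC t xi (Y *m J)) (KC t xi Y).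
have key (a b c k1 k2 p q x y : R) : a - b - c + p * x + - (q * - y) = 0 ->
  a + k1 + k2 = b + k1 - p * x + (c + k2 - q * y) by lra.
exact: key.
Qed.

Lemma nabla_xi_lin1 a X X' Z : nabla_xi (a *: X + X') Z = a * nabla_xi X Z + nabla_xi X' Z.
Proof.
by rewrite /nabla_xi dxi_lin ipDl ipZl koszul_form_lin// pairingD pairingZ; ring.
Qed.

Lemma nabla_xi_lin2 a X Z Z' : nabla_xi X (a *: Z + Z') = a * nabla_xi X Z + nabla_xi X Z'.
Proof.
by rewrite /nabla_xi !ipDr !ipZr koszul_form_linr//; ring.
Qed.

Let nabla_xiNr X Z : nabla_xi X (- Z) = - nabla_xi X Z.
Proof.
have N0 : nabla_xi X 0 = 0.
  by have := nabla_xi_lin2 (-1) X 0 0; rewrite scaler0 addr0 mulN1r addNr.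
by rewrite -[- Z]addr0 -scaleN1r nabla_xi_lin2 N0 mulN1r addr0.
Qed.

Variable e2 : 'rV[R]_4.
Local Notation e0 := xi.
Local Notation e1 := (xi *m J).
Local Notation e3 := (e2 *m J).
Hypotheses (e2_unit : ip C e2 e2 = 1) (e02 : ip C e0 e2 = 0) (e12 : ip C e1 e2 = 0).
Hypothesis J_asd : star2 C (J *m C) = - (J *m C).

Let ip_skew X : ip C X (X *m J) = 0.
Proof.
have := J_skew X X; rewrite CC.
have key (a : R) : a = - a -> a = 0 by lra.
exact: key.
Qed.

Let ip_iso X Y : ip C (X *m J) (Y *m J) = ip C X Y.
Proof. by rewrite J_skew JJ ipNr opprK. Qed.

Let e01 : ip C e0 e1 = 0. Proof. exact: ip_skew. Qed.
Let e11 : ip C e1 e1 = 1. Proof. by rewrite ip_iso. Qed.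
Let e23 : ip C e2 e3 = 0. Proof. exact: ip_skew. Qed.
Let e33 : ip C e3 e3 = 1. Proof. by rewrite ip_iso. Qed.
Let e03 : ip C e0 e3 = 0.
Proof. by have := J_skew e0 e2; rewrite e12 => /esym/eqP; rewrite oppr_eq0 => /eqP. Qed.
Let e13 : ip C e1 e3 = 0. Proof. by rewrite ip_iso. Qed.
Let frame_ip := (xi_unit, e2_unit, e02, e12, e01, e11, e23, e33, e03, e13,
  CC e2 e0, CC e2 e1, CC e1 e0, CC e3 e2, CC e3 e0, CC e3 e1).

Let E : 'M[R]_4 := \matrix_i tnth [tuple e0; e1; e2; e3] i.

Let orthonormal : E *m C *m E^T = 1%:M.
Proof.
have coef i j : (E *m C *m E^T) i j =
    ip C (tnth [tuple e0; e1; e2; e3] i) (tnth [tuple e0; e1; e2; e3] j).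
  rewrite /ip -(rowK (tnth [tuple e0; e1; e2; e3]) i) -/E -row_mul mxE [RHS]mxE.
  by apply: eq_bigr => k _; rewrite !mxE.
apply/matrixP => i j; rewrite coef mxE.
case: i => [[|[|[|[|i]]]] Hi] //; case: j => [[|[|[|[|j]]]] Hj] //;
  by rewrite !(tnth_nth 0) /= ?frame_ip.
Qed.

Let expand X := frame_expand orthonormal X.

Let skew_J_form X Y : ip (J *m C) X Y = - ip (J *m C) Y X.
Proof.
have E' X' Y' : ip (J *m C) X' Y' = ip C (X' *m J) Y' by rewrite /ip mulmxA.
by rewrite !E' J_skew CC.
Qed.

(** The 2-form of [J] takes the value [1] on [(e0, e1)] and on [(e2, e3)], and
    the star operator exchanges these values up to minus the orientation of the
    frame. *)
Lemma frame_vol : vol [tuple e0; e1; e2; e3] = 1.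
Proof.
have [+ _ _] := star2_frame orthonormal skew_J_form.
have E' X' Y' : ip (J *m C) X' Y' = ip C (X' *m J) Y' by rewrite /ip mulmxA.
rewrite J_asd -scaleN1r ipZm !E' e33 e11 mulr1 mulN1r => /oppr_inj <-.
by [].
Qed.

Lemma linear_frame (f : 'rV[R]_4 -> R) X : (forall a X Y, f (a *: X + Y) = a * f X + f Y) ->
  f X = ip C X e0 * f e0 + ip C X e1 * f e1 + ip C X e2 * f e2 + ip C X e3 * f e3.
Proof.
move=> fl; have f0 : f 0 = 0.
  by have := fl (-1) 0 0; rewrite scaler0 addr0 mulN1r addNr.
rewrite {1}(expand X) -!addrA !fl -[ip C X e3 *: e3]addr0 fl f0 addr0.
by [].
Qed.

(** A skew endomorphism anticommuting with [J] that kills [xi] kills [J xi] too;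
    on the orthogonal plane it is skew and anticommutes with a rotation. *)
Lemma nabla_J_eq0 t' X : (forall Z, nabla_J t' X xi Z = 0) ->
  forall Y Z, nabla_J t' X Y Z = 0.
Proof.
move=> H0.
have H1 Z : nabla_J t' X e1 Z = 0 by rewrite nabla_J_J H0.
have H0' Z : nabla_J t' X Z e0 = 0 by rewrite nabla_J_skew H0 oppr0.
have H1' Z : nabla_J t' X Z e1 = 0 by rewrite nabla_J_skew H1 oppr0.
have key (a : R) : a = - a -> a = 0 by lra.
have H22 Y : nabla_J t' X Y Y = 0 by apply: key; exact: nabla_J_skew.
have H23 : nabla_J t' X e2 e3 = 0 by apply: key; rewrite {1}nabla_J_skew nabla_J_J.
have H32 : nabla_J t' X e3 e2 = 0 by rewrite nabla_J_J H23.
have H2 Z : nabla_J t' X e2 Z = 0.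
  rewrite (linear_frame (f := nabla_J t' X e2)); last by move=> *; exact: nabla_J_lin3.
  by rewrite H0' H1' H22 H23 !mulr0 !addr0.
have H3 Z : nabla_J t' X e3 Z = 0.
  rewrite (linear_frame (f := nabla_J t' X e3)); last by move=> *; exact: nabla_J_lin3.
  by rewrite H0' H1' H22 H32 !mulr0 !addr0.
move=> Y Z; rewrite (linear_frame (f := fun Y => nabla_J t' X Y Z)); last first.
  by move=> *; exact: nabla_J_lin2.
by rewrite H0 H1 H2 H3 !mulr0 !addr0.
Qed.

Variable cv : 'rV[R]_4 -> 'rV[R]_4.
Hypothesis cv_lin : forall a X Y, cv (a *: X + Y) = a *: cv X + cv Y.
Hypothesis ip_cv : forall X Z, ip C (cv X) Z = nabla_xi X Z.
Hypothesis divergence_free : \sum_k cv (delta_mx 0 k) 0 k = 0.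

(** [tr D xi = 0] *)
Lemma trace_frame :
  nabla_xi e0 e0 + nabla_xi e1 e1 + nabla_xi e2 e2 + nabla_xi e3 e3 = 0.
Proof.
pose A : 'M[R]_4 := \matrix_k cv (delta_mx 0 k).
have cvE X : cv X = X *m A.
  apply/rowP => j; rewrite mxE (linear_formE (f := fun X => cv X 0 j)); last first.
    by move=> a Y Z; rewrite cv_lin !mxE.
  by apply: eq_bigr => k _; rewrite !mxE.
have trA : \tr A = 0.
  by rewrite -divergence_free; apply: eq_bigr => k _; rewrite !mxE.
have : \tr (E *m A *m C *m E^T) = 0.
  rewrite mxtrace_mulC !mulmxA -(invmx_frame orthonormal) -mulmxA mxtrace_mulC -mulmxA.
  rewrite (invmx_frame orthonormal).
  have -> : C *m (E^T *m E) = 1%:M.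
    by rewrite mulmxA; apply: mulmx1C; rewrite mulmxA orthonormal.
  by rewrite mulmx1.
rewrite /mxtrace !big_ord_recl big_ord0.
have coef i : (E *m A *m C *m E^T) i i = nabla_xi (tnth [tuple e0; e1; e2; e3] i)
    (tnth [tuple e0; e1; e2; e3] i).
  rewrite -ip_cv cvE /ip -(rowK (tnth [tuple e0; e1; e2; e3]) i) -/E -2!row_mul [LHS]mxE [RHS]mxE.
  by apply: eq_bigr => k _; rewrite !mxE.
by rewrite !coef !(tnth_nth 0) /= addr0 !addrA.
Qed.

Let nabla_J_diag t' X : nabla_J t' X xi xi = 0 /\ nabla_J t' X xi e1 = 0.
Proof.
have key (a : R) : a = - a -> a = 0 by lra.
split; apply: key; first exact: nabla_J_skew.
by rewrite {1}nabla_J_skew nabla_J_J.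
Qed.

(** The commutator of [D xi] with [J] is skew by [nabla_J_invariant], so the
    symmetric part of [D xi] commutes with [J].  It also kills [xi], hence
    [J xi], and a traceless symmetric map commuting with a rotation of the
    remaining plane is zero. *)
Lemma nabla_xi_frame (p := nabla_J t xi xi e2) (q := nabla_J t xi xi e3) :
  [/\ nabla_xi e1 e1 = 0, nabla_xi e1 e2 = p, nabla_xi e1 e3 = q &
   [/\ nabla_xi e2 e1 = - p, nabla_xi e3 e1 = - q, nabla_xi e3 e2 = - nabla_xi e2 e3,
       nabla_xi e2 e2 = 0 & nabla_xi e3 e3 = 0]].
Proof.
have inv := nabla_J_invariant.
have [d0 d1] := nabla_J_diag t xi.
have key (a : R) : a = - a -> a = 0 by lra.
have b11 : nabla_xi e1 e1 = 0.
  by have := inv e0 e1; rewrite d1 geodesic addr0 => <-.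
have b12 : nabla_xi e1 e2 = p by have := inv e0 e2; rewrite geodesic addr0 => <-.
have b13 : nabla_xi e1 e3 = q by have := inv e0 e3; rewrite geodesic addr0 => <-.
have b21 : nabla_xi e2 e1 = - p.
  by have := inv e2 e0; rewrite nabla_xi_xi add0r => <-; exact: nabla_J_skew.
have b31 : nabla_xi e3 e1 = - q.
  have := inv e3 e0; rewrite nabla_xi_xi add0r => <-; exact: nabla_J_skew.
have b32 : nabla_xi e3 e2 = - nabla_xi e2 e3.
  have := inv e2 e2; rewrite (key _ (nabla_J_skew t xi e2 e2)) => /esym/eqP.
  by rewrite addr_eq0 => /eqP.
have b33 : nabla_xi e3 e3 = nabla_xi e2 e2.
  have := inv e2 e3; rewrite JJ nabla_xiNr.
  rewrite (key (nabla_J t xi e2 e3)); last by rewrite {1}nabla_J_skew nabla_J_J.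
  by move=> /esym/eqP; rewrite subr_eq0 => /eqP.
have := trace_frame; rewrite geodesic b11 b33 !add0r => tr.
have key2 (a : R) : a + a = 0 -> a = 0 by lra.
have b22 : nabla_xi e2 e2 = 0.
  by apply: (key2 _ tr).
by split => //; split => //; rewrite b33.
Qed.

Variables (G : 'M[R]_4) (om : 'rV[R]_4).
Hypothesis ip_G : forall X Y, ip G X Y = nabla_xi X Y - nabla_xi Y X.
Hypothesis pairing_om : forall Z, pairing om Z = - ip (star2 C G) xi Z.

(** [omega / 2] is the curl of [xi], with components those of the skew map
    [D xi]. *)
Lemma pairing_om_frame :
  [/\ pairing om e0 = 0, pairing om e1 = 2 * nabla_xi e2 e3,
      pairing om e2 = - 2 * nabla_J t xi xi e3 & pairing om e3 = 2 * nabla_J t xi xi e2].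
Proof.
have G_skew X Y : ip G X Y = - ip G Y X.
  by rewrite (ip_G X) (ip_G Y) [RHS]opprB.
have [s1 s2 s3] := star2_frame orthonormal G_skew.
have [b11 b12 b13 [b21 b31 b32 b22 b33]] := nabla_xi_frame.
have key (b p q : R) : [/\ - (- (b - - b) * 1) = 2 * b,
    - (- (- q - q) * 1) = - 2 * q & - (- (p - - p) * 1) = 2 * p] by split; ring.
rewrite !pairing_om s1 s2 s3 frame_vol !ip_G b12 b13 b21 b31 b32.
have [k1 k2 k3] := key (nabla_xi e2 e3) (nabla_J t xi xi e2) (nabla_J t xi xi e3).
split=> //.
rewrite ip_star2 big1 ?mulr0 ?oppr0// => a _; rewrite big1// => b _.
by rewrite vol4_alt34 mulr0.
Qed.

(** The 1-form of [D^sd - kappa xi - tau chi] relative to [D^0] *)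
Definition twist (tau kappa : R) : 'rV[R]_4 :=
  2^-1 *: om - kappa *: (xi *m C) - tau *: (xi *m J *m C).

Lemma pairing_twist tau kappa Z : pairing (twist tau kappa) Z =
  2^-1 * pairing om Z - kappa * ip C xi Z - tau * ip C e1 Z.
Proof. by rewrite /twist !pairingDl !pairingNl !pairingZl !pairing_ip. Qed.

(** [<D^B_X chi, Z>], where [D^B = D^0 + om] *)
Definition nabla_chi X Z : R := nabla_J t X xi Z - nabla_xi X (Z *m J)
  + pairing om e1 * ip C X Z - ip C X e1 * pairing om Z.

(** The derivative of [J] cancels between the two sides.  What remains is a
    bilinear form [F] in [D xi], [om] and [kappa], which vanishes on the
    horizontal part of the frame.  For the [kappa] term, [vol (chi, X, Z, xi)]
    is [<X, J Z>] on the plane of [e2] and [e3]. *)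
Lemma nabla_chi_twist tau kappa X Z : ip C xi X = 0 -> ip C xi Z = 0 ->
  nabla_chi X Z = nabla_J (t + twist tau kappa) X xi Z
    + (tau * (ip C X Z - ip C e1 X * ip C e1 Z) + kappa * vol [tuple e1; X; Z; xi]).
Proof.
move=> hX hZ.
have [w0 w1 w2 w3] := pairing_om_frame.
have [b11 b12 b13 [b21 b31 b32 b22 b33]] := nabla_xi_frame.
pose F X Z := - nabla_xi X (Z *m J) + 2^-1 * (pairing om e1 * ip C X Z)
  - 2^-1 * (ip C X e1 * pairing om Z) + kappa * (ip C X (Z *m J) - vol [tuple e1; X; Z; xi]).
have F1 a X1 X2 W : F (a *: X1 + X2) W = a * F X1 W + F X2 W.
  by rewrite /F nabla_xi_lin1 vol4_lin2 !(ipDl, ipZl); ring.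
have F2 W a X1 X2 : F W (a *: X1 + X2) = a * F W X1 + F W X2.
  rewrite /F mulmxDl -scalemxAl nabla_xi_lin2 vol4_lin3 !(ipDr, ipZr) pairingD pairingZ; ring.
have vol1 := frame_vol.
have v0 X1 X2 : (vol [tuple e1; e1; X1; X2] = 0) * (vol [tuple e1; X1; e1; X2] = 0) *
  (vol [tuple e1; X1; X1; X2] = 0) by rewrite vol4_alt12 vol4_alt13 vol4_alt23.
have v23 : vol [tuple e1; e2; e3; xi] = -1.
  by rewrite vol4_swap34 vol4_swap23 vol4_swap12 opprK vol1.
have v32 : vol [tuple e1; e3; e2; xi] = 1 by rewrite vol4_swap23 v23 opprK.
have F0 : F X Z = 0.
  have FX W : F X W = ip C X e1 * F e1 W + ip C X e2 * F e2 W + ip C X e3 * F e3 W.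
    rewrite (linear_frame (f := F ^~ W)); last by move=> *; exact: F1.
    by rewrite [ip C X xi]CC hX mul0r add0r.
  have FZ : F X Z = ip C Z e1 * F X e1 + ip C Z e2 * F X e2 + ip C Z e3 * F X e3.
    rewrite (linear_frame (f := F X)); last by move=> *; exact: F2.
    by rewrite [ip C Z xi]CC hZ mul0r add0r.
  have [f1 f2 f3] : [/\ F X e1 = 0, F X e2 = 0 & F X e3 = 0]; last first.
    by rewrite FZ f1 f2 f3 !mulr0 !addr0.
  move: (ip C X e1) (ip C X e2) (ip C X e3) FX => x1 x2 x3 FX.
  rewrite !FX /F !JJ !(nabla_xiNr, ipNr) !frame_ip !v0 v23 v32 !nabla_xi_xi.
  rewrite w1 w2 w3 b12 b13 b32 b22 b33.
  move: (nabla_xi e2 e3) (nabla_J _ _ _ _) (nabla_J _ _ _ _) => b p q.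
  by split; field.
move: F0; rewrite /F /nabla_chi nabla_J_shift !pairing_twist !frame_ip w0.
rewrite [ip C X xi]CC hX hZ.
have -> : ip C xi (Z *m J) = - ip C e1 Z by rewrite J_skew opprK.
have -> : ip C e1 (Z *m J) = 0 by rewrite ip_iso.
rewrite (CC X e1).
have key (b w1' xz x1 wz k' xzj v a z1 wzj : R) :
  - b + 2^-1 * (w1' * xz) - 2^-1 * (x1 * wz) + k' * (xzj - v) = 0 ->
  a - b + w1' * xz - x1 * wz = a + (2^-1 * w1' - k' * 0 - tau * 1) * xz
    - (2^-1 * wz - k' * 0 - tau * z1) * x1 + (2^-1 * 0 - k' * 1 - tau * 0) * xzj
    - (2^-1 * wzj - k' * - z1 - tau * 0) * 0 + (tau * (xz - x1 * z1) + k' * v).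
  by move=> E'; apply/eqP; rewrite -subr_eq0; apply/eqP; rewrite -[RHS]E'; field.
exact: key.
Qed.

(** The equations of [D J = 0] in the direction [xi] hold for all [tau] and
    [kappa]: the half of [om] in [D^sd] balances the derivative of [J] given by
    [nabla_J_invariant]. *)
Let nabla_J_twist_xi tau kappa Z : nabla_J (t + twist tau kappa) xi xi Z = 0.
Proof.
have [w0 w1 w2 w3] := pairing_om_frame.
have [d0 d1] := nabla_J_diag (t + twist tau kappa) xi.
rewrite (linear_frame (f := nabla_J _ xi xi)); last by move=> *; exact: nabla_J_lin3.
rewrite d0 d1 !nabla_J_shift !JJ !pairingN !pairing_twist !(ipNr, ipNl) !frame_ip w2 w3.
move: (ip C Z e2) (ip C Z e3) (nabla_J _ _ _ _) (nabla_J _ _ _ _) (pairing om _) => *.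
by field.
Qed.

Lemma parallel_iff_shear_free tau kappa :
  (forall X Y Z, nabla_J (t + twist tau kappa) X Y Z = 0) <->
  (forall X Z, ip C xi X = 0 -> ip C xi Z = 0 -> nabla_chi X Z =
    tau * (ip C X Z - ip C e1 X * ip C e1 Z) + kappa * vol [tuple e1; X; Z; xi]).
Proof.
split=> [H X Z hX hZ|H]; first by rewrite (nabla_chi_twist tau kappa)// H add0r.
have H1 X Z : ip C xi X = 0 -> ip C xi Z = 0 -> nabla_J (t + twist tau kappa) X xi Z = 0.
  move=> hX hZ; have := nabla_chi_twist tau kappa hX hZ; rewrite H//.
  by rewrite -[LHS]add0r => /addIr.
have H2 X Z : ip C xi X = 0 -> nabla_J (t + twist tau kappa) X xi Z = 0.
  move=> hX; rewrite (linear_frame (f := nabla_J _ X xi)); last first.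
    by move=> *; exact: nabla_J_lin3.
  by have [-> _] := nabla_J_diag (t + twist tau kappa) X; rewrite !H1 ?frame_ip// !mulr0 !addr0.
move=> X Y Z; apply: nabla_J_eq0 => {}Z.
rewrite (linear_frame (f := fun X => nabla_J _ X xi Z)); last first.
  by move=> *; exact: nabla_J_lin1.
by rewrite nabla_J_twist_xi !H2 ?frame_ip// !mulr0 !addr0.
Qed.

(** [<N(X, Y), Z>], using that [J] is skew *)
Definition nijenhuis_form X Y Z : R := ip C (Y *m dJ (X *m J)) Z - ip C (X *m dJ (Y *m J)) Z
  - ip C (X *m dJ Y) (Z *m J) + ip C (Y *m dJ X) (Z *m J).

(** In the Nijenhuis tensor the Lie brackets may be computed with any
    torsion-free connection. *)
Lemma nijenhuis_form_nabla t' X Y Z : nijenhuis_form X Y Z =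
  nabla_J t' (X *m J) Y Z - nabla_J t' (Y *m J) X Z
  + nabla_J t' X Y (Z *m J) - nabla_J t' Y X (Z *m J).
Proof.
rewrite /nijenhuis_form /nabla_J !JJ (KC t' (X *m J) (Y *m J)) (KC t' (X *m J) Y).
rewrite (KC t' X (Y *m J)) (KC t' X Y); ring.
Qed.

(** Let [p_i] and [q_i] be the components of [(D_{e_i} J) xi] along [e2] and [e3].
    The Nijenhuis tensor on [(e0, e2)] vanishes if and only if [p_1 = - q_0],
    [q_1 = p_0], [q_2 = - p_3] and [q_3 = p_2].  As [p_0] and [q_0] are prescribed
    by invariance, [p_2] and [p_3] remain; [tau] and [kappa] are chosen so that
    the twist removes them. *)
Lemma integrable_iff_parallel : (forall X Y Z, nijenhuis_form X Y Z = 0) <->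
  exists tau kappa, forall X Y Z, nabla_J (t + twist tau kappa) X Y Z = 0.
Proof.
split=> [N|[tau [kappa H]] X Y Z]; last first.
  by rewrite (nijenhuis_form_nabla (t + twist tau kappa)) !H !subr0 addr0.
have [w0 w1 w2 w3] := pairing_om_frame.
have key (a : R) : a = - a -> a = 0 by lra.
have N' X Y Z : nabla_J t (X *m J) Y Z - nabla_J t (Y *m J) X Z
  + nabla_J t X Y (Z *m J) - nabla_J t Y X (Z *m J) = 0.
  by rewrite -nijenhuis_form_nabla N.
have diag t' X Y : nabla_J t' X Y Y = 0 by apply: key; exact: nabla_J_skew.
have diagJ t' X Y : nabla_J t' X Y (Y *m J) = 0.
  by apply: key; rewrite {1}nabla_J_skew nabla_J_J.
have Nr X Y Z : nabla_J t X Y (- Z) = - nabla_J t X Y Z.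
  have N0 : nabla_J t X Y 0 = 0.
    by have := nabla_J_lin3 t (-1) X Y 0 0; rewrite scaler0 addr0 mulN1r addNr.
  by rewrite -[- Z]addr0 -scaleN1r nabla_J_lin3 N0 mulN1r addr0.
have sk X Y : nabla_J t X Y xi = - nabla_J t X xi Y by exact: nabla_J_skew.
have E1 := N' xi e2 xi.
rewrite (diag t e3) (diagJ t e2) -(nabla_J_J t xi e2) !sk in E1.
have E2 := N' xi e2 e1.
rewrite JJ !Nr -(nabla_J_J t e1 e2) (diag t e2) (diagJ t e3) !sk in E2.
have E3 := N' xi e2 e2.
rewrite (diag t e1) (diagJ t xi) in E3.
have E4 := N' xi e2 e3.
rewrite JJ !Nr (diag t xi) (diagJ t e1) in E4.
exists (nabla_J t e2 xi e2 + 2^-1 * pairing om e1), (nabla_J t e3 xi e2).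
set tau := (X in twist X _); set kappa := (X in twist _ X).
have H X Z : ip C Z e2 * nabla_J (t + twist tau kappa) X xi e2 +
    ip C Z e3 * nabla_J (t + twist tau kappa) X xi e3 = nabla_J (t + twist tau kappa) X xi Z.
  rewrite [RHS](linear_frame (f := nabla_J _ X xi)); last by move=> *; exact: nabla_J_lin3.
  by rewrite (diag _ X) (diagJ _ X) !mulr0 !add0r.
have H1 Z : nabla_J (t + twist tau kappa) e1 xi Z = 0.
  rewrite -H !nabla_J_shift !JJ !pairingN !pairing_twist !(ipNr, ipNl) !frame_ip w2 w3.
  move: E1 E2; move: (ip C Z e2) (ip C Z e3) (nabla_J t e1 xi e2) (nabla_J t e1 xi e3) (nabla_J t xi xi e2) (nabla_J t xi xi e3) => x2 x3 p1 q1 p0 q0 E1 E2.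
  have -> : p1 = - q0 by lra. 
  have -> : q1 = p0 by lra. 
  by field.
have H2 Z : nabla_J (t + twist tau kappa) e2 xi Z = 0.
  rewrite -H !nabla_J_shift !JJ !pairingN !pairing_twist !(ipNr, ipNl) !frame_ip w0 /tau /kappa.
  have -> : nabla_J t e2 xi e3 = - nabla_J t e3 xi e2 by apply/eqP; rewrite -addr_eq0; apply/eqP; lra.
  by field.
have H3 Z : nabla_J (t + twist tau kappa) e3 xi Z = 0.
  rewrite -H !nabla_J_shift !JJ !pairingN !pairing_twist !(ipNr, ipNl) !frame_ip w0 /tau /kappa.
  have -> : nabla_J t e3 xi e3 = nabla_J t e2 xi e2 by lra.
  by field.
move=> X Y Z; apply: nabla_J_eq0 => {}Z.
rewrite (linear_frame (f := fun X => nabla_J _ X xi Z)); last first.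
  by move=> *; exact: nabla_J_lin1.
by rewrite nabla_J_twist_xi H1 H2 H3 !mulr0 !addr0.
Qed.

End Jet.

(** * Tensor fields in a chart *)
Lemma orthogonal_unit_exists (R : realType) (C : 'M[R]_4) (a b : 'rV[R]_4) :
  C^T = C -> (forall X, X != 0 -> 0 < ip C X X) ->
  exists e, [/\ ip C e e = 1, ip C a e = 0 & ip C b e = 0].
Proof.
move=> C_sym C_pos.
pose A := row_mx (C *m a^T) (C *m b^T) : 'M[R]_(4, 1 + 1).
have kerA : kermx A != 0.
  rewrite -mxrank_eq0 mxrank_ker -lt0n subn_gt0.
  by apply: leq_ltn_trans (rank_leq_col A) _.
have v0 : nz_row (kermx A) != 0 by rewrite nz_row_eq0.
have /sub_kermxP := nz_row_sub (kermx A).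
move: (nz_row _) v0 => v v0; rewrite mul_mx_row => /eqP.
rewrite row_mx_eq0 => /andP[/eqP va /eqP vb].
have vv := C_pos v v0.
exists ((Num.sqrt (ip C v v))^-1 *: v); split.
- rewrite ipZl ipZr mulrA -invfM -expr2 sqr_sqrtr ?ltW// mulVf// gt_eqF//.
- by rewrite ipZr (ip_sym a v C_sym) [ip C v a]/ip -(mulmxA v) va mxE mulr0.
- by rewrite ipZr (ip_sym b v C_sym) [ip C v b]/ip -(mulmxA v) vb mxE mulr0.
Qed.

Section ChartJet.
Context {R : realType}.
Local Notation V := 'rV[R]_4.
Implicit Types X Y Z : V.
Variables (U : set V) (c J : V -> 'M[R]_4) (xi th : V -> V) (u : V).
Hypotheses (openU : open U) (Uu : U u).
Hypotheses (c_smooth : smooth_on U c) (J_smooth : smooth_on U J) (xi_smooth : smooth_on U xi).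
Hypothesis c_metric : forall v, U v ->
  [/\ (c v)^T = c v, forall X, X != 0 -> 0 < ip (c v) X X & \det (c v) = 1].
Hypothesis xi_unit : forall v, U v -> ip (c v) (xi v) (xi v) = 1.
Hypothesis J_asd : forall v, U v -> [/\ J v *m J v = - 1%:M,
  (J v *m c v)^T = - (J v *m c v) & star2 (c v) (J v *m c v) = - (J v *m c v)].
Hypothesis minimal : cov c th (-1) (xi u) xi u = 0 /\
  \sum_(k < 4) cov c th (-1) (delta_mx 0 k) xi u 0 k = 0.
Hypothesis invariant : forall Y, weyl_lie xi th (cst 1) J Y u = 0.

Let dc : differentiable c u := smooth_on_differentiable c_smooth Uu.
Let dJ : differentiable J u := smooth_on_differentiable J_smooth Uu.
Let dxi : differentiable xi u := smooth_on_differentiable xi_smooth Uu.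

Local Notation C := (c u).
Local Notation dC := (fun X => 'D_X c u).
Local Notation DJ := (fun X => 'D_X J u).
Local Notation Dxi := (fun X => 'D_X xi u).

Let c_sym : \forall v \near u, (c v)^T = c v.
Proof. by apply: eq_on_near Uu => // v /c_metric[]. Qed.
Let C_sym : C^T = C. Proof. by have [] := c_metric Uu. Qed.
Let C_pos X : X != 0 -> 0 < ip C X X. Proof. by have [_ + _] := c_metric Uu; apply. Qed.
Let c_unit : C \in unitmx.
Proof. by have [_ _ d] := c_metric Uu; rewrite unitmxE d unitr1. Qed.
Let dC_lin a X Y : dC (a *: X + Y) = a *: dC X + dC Y. Proof. exact: derive_lin. Qed.
Let dC_sym X : (dC X)^T = dC X. Proof. exact: derive_conformal_sym. Qed.
Let dJ_lin a X Y : DJ (a *: X + Y) = a *: DJ X + DJ Y. Proof. exact: derive_lin. Qed.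
Let dxi_lin a X Y : Dxi (a *: X + Y) = a *: Dxi X + Dxi Y. Proof. exact: derive_lin. Qed.
Let J2 : J u *m J u = - 1%:M. Proof. by have [] := J_asd Uu. Qed.

Let J_skew_near v X Y : U v -> ip (c v) (X *m J v) Y = - ip (c v) X (Y *m J v).
Proof.
move=> Uv; have [cs _ _] := c_metric Uv; have [_ sk _] := J_asd Uv.
have E' X' Y' : ip (J v *m c v) X' Y' = ip (c v) (X' *m J v) Y' by rewrite /ip mulmxA.
by rewrite -E' -ip_tr sk -scaleN1r ipZm mulN1r E' (ip_sym _ _ cs).
Qed.

Let J_skew X Y : ip C (X *m J u) Y = - ip C X (Y *m J u).
Proof. exact: J_skew_near. Qed.

Let DJ_row X Y : 'D_X (fun v => Y *m J v) u = Y *m 'D_X J u.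
Proof.
apply: etrans (derive_mulmx X (differentiable_cst Y u) dJ) _.
by rewrite derive_cst mul0mx add0r.
Qed.

Let dJY Y : differentiable (fun v => Y *m J v) u.
Proof. exact: differentiable_mulmx. Qed.

Let dJ2 X : DJ X *m J u + J u *m DJ X = 0.
Proof.
apply: etrans (esym (derive_mulmx X dJ dJ)) _.
have -> : 'D_X (fun v => J v *m J v) u = 'D_X (cst (- 1%:M)) u.
  by apply: near_eq_derive; apply: eq_on_near Uu => // v /J_asd[].
exact: derive_cst.
Qed.

Let dJ_skew X Y Z : ip C (Y *m DJ X) Z + ip C Y (Z *m DJ X)
  + ip (dC X) (Y *m J u) Z + ip (dC X) Y (Z *m J u) = 0.
Proof.
have E1 := derive_ip X dc (dJY Y) (differentiable_cst Z u).
have E2 := derive_ip X dc (differentiable_cst Y u) (dJY Z).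
rewrite DJ_row derive_cst ip0r addr0 in E1.
rewrite DJ_row derive_cst ip0l add0r in E2.
have E : 'D_X (fun v => ip (c v) (Y *m J v) Z) u = - 'D_X (fun v => ip (c v) Y (Z *m J v)) u.
  rewrite -deriveN; last by apply: diff_derivable; exact: differentiable_ip.
  by apply: near_eq_derive; apply: eq_on_near Uu => // v Uv; rewrite J_skew_near.
move: E; rewrite E1 E2 /= => /eqP; rewrite -addr_eq0 => /eqP E.
by rewrite -[RHS]E; ring.
Qed.

Let dxi_unit X : 2 * ip C (Dxi X) (xi u) + ip (dC X) (xi u) (xi u) = 0.
Proof.
have E1 := derive_ip X dc dxi dxi.
have E : 'D_X (fun v => ip (c v) (xi v) (xi v)) u = 0.
  rewrite -(derive_cst (1 : R) u X).
  by apply: near_eq_derive; apply: eq_on_near Uu => // v Uv; rewrite xi_unit.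
rewrite E (ip_sym (xi u) _ C_sym) in E1.
rewrite [RHS]E1; ring.
Qed.

Lemma ip_cov_endo th' X Y Z :
  ip C (cov_endo c th' X J Y u) Z = nabla_J C dC (J u) DJ (th' u) X Y Z.
Proof.
rewrite /cov_endo ipDl ipNl J_skew opprK (ip_cov th' dc c_unit 0 X (fun v => Y *m J v)).
rewrite (ip_cov th' dc c_unit 0 X (cst Y)) DJ_row derive_cst ip0l /nabla_J; ring.
Qed.

Lemma ip_cov_xi X Z :
  ip C (cov c th (-1) X xi u) Z = nabla_xi C dC (th u) (xi u) Dxi X Z.
Proof. by rewrite (ip_cov th dc c_unit) /nabla_xi; ring. Qed.

(** [d^D xi] is the skew part of [D xi] because [D] is torsion-free: the
    Koszul term with [xi] as last argument is symmetric and drops out. *)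
Lemma ip_ext_d_flat X Y : ip (ext_d th 1 (fun v => xi v *m c v) u) X Y =
  nabla_xi C dC (th u) (xi u) Dxi X Y - nabla_xi C dC (th u) (xi u) Dxi Y X.
Proof.
pose N := nabla_xi C dC (th u) (xi u) Dxi.
have Nl a X1 X2 Z : N (a *: X1 + X2) Z = a * N X1 Z + N X2 Z by exact: nabla_xi_lin1.
have Nr a X1 X2 Z : N Z (a *: X1 + X2) = a * N Z X1 + N Z X2 by exact: nabla_xi_lin2.
rewrite [RHS](linear_formE (f := fun X => N X Y - N Y X)); last first.
  by move=> a X1 X2; rewrite Nl Nr; ring.
rewrite [LHS](linear_formE (f := fun X => ip _ X Y)); last by move=> *; rewrite ipDl ipZl.
apply: eq_bigr => i _; congr (_ * _).
rewrite [RHS](linear_formE (f := fun Y => N _ Y - N Y _)); last first.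
  by move=> a X1 X2; rewrite Nl Nr; ring.
rewrite [LHS](linear_formE (f := fun Y => ip _ _ Y)); last by move=> *; rewrite ipDr ipZr.
apply: eq_bigr => j _; congr (_ * _); rewrite ip_delta mxE.
have E k l : cov_density th 1 (delta_mx 0 k) (fun v => (xi v *m c v) 0 l) u =
    N (delta_mx 0 k) (delta_mx 0 l)
    + koszul_form dC C (th u) (delta_mx 0 k) (delta_mx 0 l) (xi u).
  have -> : (fun v => (xi v *m c v) 0 l) = (fun v => ip (c v) (xi v) (delta_mx 0 l)).
    by apply/funext => v; rewrite -pairing_ip pairing_delta.
  rewrite /cov_density (derive_ip _ dc dxi (differentiable_cst _ u)) derive_cst ip0r addr0.
  have := koszul_form_metric (th u) C_sym dC_sym (delta_mx 0 k) (xi u) (delta_mx 0 l).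
  rewrite /N /nabla_xi /=.
  have key (a b p q k1 k2 : R) : k1 + k2 = b + 2 * p * q -> a + b + 1 * p * q = a + k1 - p * q + k2.
    move=> e; have -> : b = k1 + k2 - 2 * p * q by rewrite e; ring.
    ring.
  exact: key.
rewrite !E [X in _ - (_ + X)]koszul_formC//; ring.
Qed.


Let geodesic Z : nabla_xi C dC (th u) (xi u) Dxi (xi u) Z = 0.
Proof. by rewrite -ip_cov_xi minimal.1 ip0l. Qed.

Let invariant_form Y : Y *m DJ (xi u) - Dxi (Y *m J u) + Dxi Y *m J u
  + pairing (th u) (Y *m J u) *: xi u - pairing (th u) Y *: (xi u *m J u) = 0.
Proof.
have := invariant Y; rewrite /weyl_lie /lie_endo /lie.
have -> : (fun v => cst 1 v *: xi v) = xi by apply/funext => v; rewrite scale1r.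
rewrite DJ_row !derive_cst sub0r mulNmx opprK invr1 !scale1r /cov_density !derive_cst.
rewrite !add0r !mul1r !mulr1 -scalemxAl !addrA.
by [].
Qed.

Let cv X := cov c th (-1) X xi u.

Let cv_lin a X Y : cv (a *: X + Y) = a *: cv X + cv Y.
Proof.
have cvE W Z : ip C (cv W) Z = nabla_xi C dC (th u) (xi u) Dxi W Z by exact: ip_cov_xi.
apply: (ip_inj c_unit) => Z; rewrite (ipDl C (a *: cv X) (cv Y)) (ipZl C a (cv X)) !cvE.
exact: nabla_xi_lin1.
Qed.

Let chi v := xi v *m J v.
Let G := ext_d th 1 (fun v => xi v *m c v) u.
Let om := - (xi u *m star2 C G).

Let pairing_om Z : pairing om Z = - ip (star2 C G) (xi u) Z.
Proof. by rewrite pairingNl pairing_ip. Qed.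

Lemma ip_cov_chi thB X Z : thB u = th u + om ->
  ip C (cov c thB (-1) X chi u) Z =
  nabla_chi C dC (th u) (J u) DJ (xi u) Dxi om X Z.
Proof.
move=> thBE; rewrite (ip_cov thB dc c_unit) thBE.
have -> : 'D_X chi u = 'D_X xi u *m J u + xi u *m 'D_X J u by exact: derive_mulmx.
rewrite koszul_form_shift ipDl J_skew /nabla_chi /nabla_J /nabla_xi /= !pairingDl.
rewrite /chi (ip_sym X (xi u *m J u) C_sym) J_skew; ring.
Qed.

Let twisted tau kappa := th u + twist C (J u) (xi u) om tau kappa.

Lemma parallel_at_iff tau kappa th' thB : th' u = twisted tau kappa -> thB u = th u + om ->
  (forall X Y, cov_endo c th' X J Y u = 0) <->
  (forall X Z, ip C (xi u) X = 0 -> ip C (xi u) Z = 0 ->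
    ip C (cov c thB (-1) X chi u) Z =
    tau * (ip C X Z - ip C (chi u) X * ip C (chi u) Z) + kappa * vol [tuple chi u; X; Z; xi u]).
Proof.
move=> th'E thBE.
have [e2 [e22 e02 e12]] := orthogonal_unit_exists (xi u) (xi u *m J u) C_sym C_pos.
have [_ _ asd] := J_asd Uu.
have H := parallel_iff_shear_free C_sym dC_lin dC_sym dJ_lin dxi_lin J2 dJ2 J_skew dJ_skew
  (xi_unit Uu) dxi_unit geodesic invariant_form e22 e02 e12 asd cv_lin
  (ip_cov_xi) minimal.2 ip_ext_d_flat pairing_om tau kappa.
split=> [P X Z hX hZ|P X Y].
  rewrite (ip_cov_chi X Z thBE); apply: H.1 => // X' Y' Z'.
  by have := ip_cov_endo th' X' Y' Z'; rewrite P ip0l th'E => <-.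
apply: (ip_inj c_unit) => Z; rewrite ip0l (ip_cov_endo th' X Y Z) th'E.
by apply: H.2 => X' Z' hX hZ; rewrite -(ip_cov_chi X' Z' thBE) P.
Qed.

Lemma ip_nijenhuis X Y Z : ip C (nijenhuis J X Y u) Z = nijenhuis_form C (J u) DJ X Y Z.
Proof.
have sub2 (A B A' B' : V) : A = A' -> B = B' -> A - B = A' - B' by move=> -> ->.
have L1 : lie (fun v => X *m J v) (fun v => Y *m J v) u =
    Y *m DJ (X *m J u) - X *m DJ (Y *m J u) by exact: sub2 (DJ_row _ _) (DJ_row _ _).
have L2 : lie (fun v => X *m J v) (cst Y) u = 0 - X *m DJ Y.
  by exact: sub2 (derive_cst _ _ _) (DJ_row _ _).
have L3 : lie (cst X) (fun v => Y *m J v) u = Y *m DJ X - 0.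
  by exact: sub2 (DJ_row _ _) (derive_cst _ _ _).
have L4 : lie (cst X) (cst Y) u = 0 - 0 by exact: sub2 (derive_cst _ _ _) (derive_cst _ _ _).
have combine (A1 A2 A3 A4 B1 B2 B3 B4 : V) : A1 = B1 -> A2 = B2 -> A3 = B3 -> A4 = B4 ->
    A1 - A2 *m J u - A3 *m J u - A4 = B1 - B2 *m J u - B3 *m J u - B4.
  by move=> -> -> -> ->.
have -> : nijenhuis J X Y u = Y *m DJ (X *m J u) - X *m DJ (Y *m J u)
    - (0 - X *m DJ Y) *m J u - (Y *m DJ X - 0) *m J u - (0 - 0).
  exact: combine L1 L2 L3 L4.
rewrite /nijenhuis_form.
move: ('D__ J u) ('D__ J u) ('D__ J u) ('D__ J u) => S1 S2 S3 S4.
by rewrite sub0r mulNmx !subr0 !(ipDl, ipNl) !J_skew; ring.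
Qed.

Lemma integrable_at_iff thB : thB u = th u + om ->
  (forall X Y, nijenhuis J X Y u = 0) <->
  exists tau kappa, forall X Z, ip C (xi u) X = 0 -> ip C (xi u) Z = 0 ->
    ip C (cov c thB (-1) X chi u) Z =
    tau * (ip C X Z - ip C (chi u) X * ip C (chi u) Z) + kappa * vol [tuple chi u; X; Z; xi u].
Proof.
move=> thBE.
have [e2 [e22 e02 e12]] := orthogonal_unit_exists (xi u) (xi u *m J u) C_sym C_pos.
have [_ _ asd] := J_asd Uu.
have H := integrable_iff_parallel C_sym dC_lin dC_sym dJ_lin J2 dJ2 J_skew dJ_skew
  (xi_unit Uu) dxi_unit geodesic invariant_form e22 e02 e12 asd cv_lin
  (ip_cov_xi) minimal.2 ip_ext_d_flat pairing_om.
have P tau kappa := parallel_at_iff (th' := cst (twisted tau kappa)) erefl thBE.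
split=> [N|[tau [kappa S]] X Y].
  have [tau [kappa K]] : exists tau kappa, forall X Y Z,
      nabla_J C dC (J u) DJ (twisted tau kappa) X Y Z = 0.
    by apply: H.1 => X Y Z; rewrite -ip_nijenhuis N ip0l.
  exists tau, kappa; apply: (P tau kappa).1 => X Y.
  by apply: (ip_inj c_unit) => Z; rewrite ip0l ip_cov_endo K.
apply: (ip_inj c_unit) => Z; rewrite ip0l ip_nijenhuis; apply: H.2; exists tau, kappa.
move=> X' Y' Z'; have := ip_cov_endo (cst (twisted tau kappa)) X' Y' Z'.
by rewrite ((P tau kappa).2 S) ip0l => /esym.
Qed.

End ChartJet.

(** * Divergence and rotation of a congruence in dimension three *)
Section ThreeDimensional.
Context {R : realType}.
Implicit Types (X Y Z : 'rV[R]_3) (C T : 'M[R]_3).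

Lemma star1_skew X : (star1 X)^T = - star1 X.
Proof. by apply/matrixP => a b; rewrite !mxE vol3_swap23. Qed.

Lemma mxtrace_sym_skew n (A S : 'M[R]_n) : A^T = A -> S^T = - S -> \tr (A *m S) = 0.
Proof.
move=> As Ss; have : \tr (A *m S) = - \tr (A *m S).
  by rewrite -[LHS]mxtrace_tr trmx_mul As Ss mulNmx raddfN/= mxtrace_mulC.
have key (a : R) : a = - a -> a = 0 by lra.
exact: key.
Qed.

Lemma star1_trace X Y : \tr (star1 X *m (star1 Y)^T) = 2 * pairing X Y.
Proof.
pose d (i : 'I_3) : 'rV[R]_3 := delta_mx 0 i.
pose i0 : 'I_3 := ord0. pose i1 : 'I_3 := lift ord0 ord0.
pose i2 : 'I_3 := lift ord0 (lift ord0 ord0).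
have v1 : vol [tuple d i0; d i1; d i2] = 1.
  rewrite -(det1 R 3) /vol; congr (\det _); apply/matrixP => i j; rewrite !mxE.
  by case: i => [[|[|[|i]]] Hi] //; case: j => [[|[|[|j]]] Hj] //;
    rewrite (tnth_nth 0) /= mxE.
have sw (A Bv Cv : 'rV[R]_3) : vol [tuple A; Bv; Cv] = - vol [tuple A; Cv; Bv] := @vol3_swap23 R A Bv Cv.
have alt12 (A Bv : 'rV[R]_3) : vol [tuple A; A; Bv] = 0.
  by apply: (@vol_alternate _ _ _ (@Ordinal 3 0 isT) (@Ordinal 3 1 isT)).
have alt13 (A Bv : 'rV[R]_3) : vol [tuple A; Bv; A] = 0 by rewrite sw alt12 oppr0.
have sw12 (A Bv Cv : 'rV[R]_3) : vol [tuple A; Bv; Cv] = - vol [tuple Bv; A; Cv].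
  apply: (alternating_swap (f := fun A Bv => vol [tuple A; Bv; Cv])) => *;
    [exact: vol3_lin1|exact: vol3_lin2|exact: alt12].
have E Z : [/\ vol [tuple Z; d i1; d i2] = Z 0 i0, vol [tuple Z; d i2; d i0] = Z 0 i1
   & vol [tuple Z; d i0; d i1] = Z 0 i2].
  split; rewrite (linear_formE (f := fun Z => vol [tuple Z; _; _]));
    try (by move=> *; exact: vol3_lin1); rewrite !big_ord_recl big_ord0.
  - by rewrite -/i0 -/i1 -/i2 -/(d i0) -/(d i1) -/(d i2) alt12 alt13 v1 !mulr0 mulr1 !addr0.
  - by rewrite -/i0 -/i1 -/i2 -/(d i0) -/(d i1) -/(d i2) alt12 alt13 sw sw12 v1 opprK !mulr0 mulr1 !addr0 add0r.
  - by rewrite -/i0 -/i1 -/i2 -/(d i0) -/(d i1) -/(d i2) alt12 alt13 sw12 sw v1 opprK !mulr0 mulr1 !addr0 !add0r.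
rewrite /mxtrace; under eq_bigr => i _ do rewrite mxE.
rewrite !big_ord_recl !big_ord0 !mxE -/i0 -/i1 -/i2 -/(d i0) -/(d i1) -/(d i2).
rewrite !vol3_alt23.
have [x0 x1 x2] := E X; have [y0 y1 y2] := E Y.
rewrite !(sw _ (d i1) (d i0)) !(sw _ (d i2) (d i1)) !(sw _ (d i0) (d i2)) x0 x1 x2 y0 y1 y2.
rewrite /pairing mxE !big_ord_recl big_ord0 !mxE -/i0 -/i1 -/i2; ring.
Qed.

Variables (C T : 'M[R]_3) (chi : 'rV[R]_3) (tau kappa : R).
Hypotheses (C_sym : C^T = C) (C_unit : C \in unitmx) (chi_unit : ip C chi chi = 1).
Hypothesis TE : forall X Z, ip T X Z =
  tau * (ip C X Z - ip C chi X * ip C chi Z) + kappa * vol [tuple chi; X; Z].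

Let TmE : T = tau *: (C - (chi *m C)^T *m (chi *m C)) + kappa *: star1 chi.
Proof.
apply/matrixP => i j; rewrite -[LHS]ip_delta TE -!pairing_ip !pairing_delta.
have -> : (tau *: (C - (chi *m C)^T *m (chi *m C)) + kappa *: star1 chi) i j =
    tau * (C i j - ((chi *m C)^T *m (chi *m C)) i j) + kappa * star1 chi i j.
  by rewrite !mxE.
have -> : ((chi *m C)^T *m (chi *m C)) i j = (chi *m C) 0 i * (chi *m C) 0 j.
  by rewrite mxE big_ord1 mxE.
by rewrite -rowE mxE [star1 _ _ _]mxE.
Qed.

(** The rotational part is skew, so it does not contribute to the trace. *)
Lemma divergence_trace : \tr (T *m invmx C) = 2 * tau.
Proof.
have iC_sym : (invmx C)^T = invmx C by rewrite trmx_inv C_sym.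
rewrite TmE mulmxDl mxtraceD -!scalemxAl !mxtraceZ.
have -> : \tr (star1 chi *m invmx C) = 0.
  by rewrite mxtrace_mulC mxtrace_sym_skew// star1_skew.
rewrite mulr0 addr0.
rewrite mulmxBl raddfB /= mulmxV// mxtrace1 -mulmxA mxtrace_mulC mulmxK//.
rewrite /mxtrace big_ord_recl big_ord0 addr0 trmx_mul C_sym mulmxA.
by rewrite -[X in _ * (_ - X)]/(ip C chi chi) chi_unit; ring.
Qed.

(** The remaining part is symmetric, so it does not contribute to the
    contraction with a skew matrix. *)
Lemma twist_trace : \tr (T *m (star1 (chi *m C))^T) = 2 * kappa.
Proof.
rewrite TmE mulmxDl mxtraceD -!scalemxAl !mxtraceZ star1_trace -[pairing _ _]/(ip C chi chi) chi_unit.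
rewrite mxtrace_sym_skew; first by ring.
- by rewrite linearB /= C_sym trmx_mul trmxK.
- by rewrite trmxK star1_skew opprK.
Qed.

End ThreeDimensional.

Section SmoothCoefficients.
Context {R : realType}.
Local Notation V := 'rV[R]_3.
Variables (U : set V) (c : V -> 'M[R]_3) (th chi : V -> V).
Hypothesis openU : open U.
Hypotheses (c_smooth : smooth_on U c) (th_smooth : smooth_on U th) (chi_smooth : smooth_on U chi).
Hypothesis c_metric : forall v, U v ->
  [/\ (c v)^T = c v, forall X, X != 0 -> 0 < ip (c v) X X & \det (c v) = 1].

(** The matrix of the bilinear form [<D_X chi, Z>] *)
Definition cov_form y : 'M[R]_3 := \matrix_(k, l)
  ip (c y) (cov c th (-1) (delta_mx 0 k) chi y) (delta_mx 0 l).

Definition divergence y : R := 2^-1 * \tr (cov_form y *m invmx (c y)).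

(** The contraction of [D chi] with the star of [chi]: raising both indices of
    the latter gives [star1] of the 1-form dual to [chi], which avoids inverting
    the metric. *)
Definition rotation y : R := 2^-1 * \tr (cov_form y *m (star1 (chi y *m c y))^T).

Let c_unit y : U y -> c y \in unitmx.
Proof. by move=> /c_metric[_ _ d]; rewrite unitmxE d unitr1. Qed.

Lemma ip_cov_form y X Z : U y -> ip (cov_form y) X Z = ip (c y) (cov c th (-1) X chi y) Z.
Proof.
move=> Uy; have dc := smooth_on_differentiable c_smooth Uy.
have dchi := smooth_on_differentiable chi_smooth Uy.
pose f X Z := ip (c y) (cov c th (-1) X chi y) Z.
have fl a X1 X2 W : f (a *: X1 + X2) W = a * f X1 W + f X2 W.
  rewrite /f !(ip_cov th dc (c_unit Uy)) (derive_lin a X1 X2 dchi) ipDl ipZl.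
  rewrite koszul_form_lin; last by move=> *; exact: derive_lin.
  rewrite pairingD pairingZ.
  have key (x1 x2 k1 k2 p1 p2 q : R) : a * x1 + x2 + (a * k1 + k2) + -1 * (a * p1 + p2) * q =
    a * (x1 + k1 + -1 * p1 * q) + (x2 + k2 + -1 * p2 * q) by ring.
  exact: key.
have fr a X1 X2 W : f W (a *: X1 + X2) = a * f W X1 + f W X2 by rewrite /f ipDr ipZr.
rewrite -[RHS]/(f X Z) [RHS](linear_formE (f := f ^~ Z)); last by move=> *; exact: fl.
rewrite [LHS](linear_formE (f := fun X => ip _ X Z)); last by move=> *; rewrite ipDl ipZl.
apply: eq_bigr => k _; congr (_ * _).
rewrite [RHS](linear_formE (f := f _)); last by move=> *; exact: fr.
rewrite [LHS](linear_formE (f := fun Z => ip _ _ Z)); last by move=> *; rewrite ipDr ipZr.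
by apply: eq_bigr => l _; rewrite ip_delta mxE.
Qed.

Let smooth_ip (A : V -> 'M[R]_3) (X Y : V -> V) :
  (forall i j, smooth_on U (fun y => A y i j)) -> (forall j, smooth_on U (fun y => X y 0 j)) ->
  (forall j, smooth_on U (fun y => Y y 0 j)) -> smooth_on U (fun y => ip (A y) (X y) (Y y)).
Proof.
move=> sA sX sY.
apply: (@smooth_on_eq _ _ _ openU _ (fun y => \sum_j (\sum_i X y 0 i * A y i j) * Y y 0 j)).
  by move=> y _; rewrite /ip mxE; apply: eq_bigr => j _; rewrite !mxE.
apply: smooth_on_sum => // j _; apply: smooth_onM => //; apply: smooth_on_sum => // i _.
exact: smooth_onM.
Qed.

Let smooth_cst (X : V) j : smooth_on U (fun=> X 0 j).
Proof. exact: smooth_on_cst. Qed.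

Lemma smooth_cov_form k l : smooth_on U (fun y => cov_form y k l).
Proof.
have schi j : smooth_on U (fun y => chi y 0 j) by exact: smooth_on_entry.
have sc i j : smooth_on U (fun y => c y i j) by exact: smooth_on_entry.
have sDc X i j : smooth_on U (fun y => ('D_X c y) i j).
  by apply: smooth_on_entry => //; exact: smooth_on_derive.
have sDchi X j : smooth_on U (fun y => ('D_X chi y) 0 j).
  by apply: smooth_on_entry => //; exact: smooth_on_derive.
have sth j : smooth_on U (fun y => th y 0 j) by exact: smooth_on_entry.
pose dk : V := delta_mx 0 k; pose dl : V := delta_mx 0 l.
pose p (y X : V) : R := \sum_j th y 0 j * X 0 j.
have pE y X : pairing (th y) X = p y X.
  by rewrite /pairing mxE; apply: eq_bigr => j _; rewrite !mxE mulrC.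
pose e (y : V) := ip (c y) ('D_dk chi y) dl
  + (2^-1 * (ip ('D_dk c y) (chi y) dl + \sum_j chi y 0 j * ('D_(delta_mx 0 j) c y) k l
      + - ip ('D_dl c y) dk (chi y))
    + p y dk * ip (c y) (chi y) dl + p y (chi y) * ip (c y) dk dl
    + - (p y dl * ip (c y) dk (chi y))) + - (p y dk * ip (c y) (chi y) dl).
have sp (X : V -> V) : (forall j, smooth_on U (fun y => X y 0 j)) ->
    smooth_on U (fun y => p y (X y)).
  by move=> sX; apply: smooth_on_sum => // j _; exact: smooth_onM.
have spc (X : V) : smooth_on U (fun y => p y X) by apply: (sp (cst X)) => j; exact: smooth_cst.
apply: (@smooth_on_eq _ _ _ openU _ e) => [y Uy|].
  have dc := smooth_on_differentiable c_smooth Uy.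
  have DE : ip ('D_(chi y) c y) dk dl = \sum_j chi y 0 j * ('D_(delta_mx 0 j) c y) k l.
    rewrite ip_delta (linear_formE (f := fun X => ('D_X c y) k l)) => // a X Y.
    by rewrite derive_lin// !mxE.
  rewrite mxE (ip_cov th dc (c_unit Uy)) /koszul_form !pE /e -DE.
  have key (x k1 k2 k3 p1 q1 p2 q2 p3 q3 : R) :
    x + (2^-1 * (k1 + k2 + - k3) + p1 * q1 + p2 * q2 + - (p3 * q3)) + - (p1 * q1) =
    x + (2^-1 * (k1 + k2 - k3) + p1 * q1 + p2 * q2 - p3 * q3) + -1 * p1 * q1 by ring.
  exact: key.
rewrite /e; repeat match goal with
  | |- smooth_on _ (fun y => _ + _) => apply: (smooth_onD openU)
  | |- smooth_on _ (fun y => - _) => apply: (smooth_onN openU)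
  | |- smooth_on _ (fun y => \sum_j _) => apply: (smooth_on_sum openU) => ? _
  | |- smooth_on _ (fun y => ip _ _ _) => apply: smooth_ip => // *
  | |- smooth_on _ (fun y => 2^-1 * _) => apply: (smooth_onM openU); first exact: smooth_on_cst
  | |- smooth_on _ (fun y => _ * _) => apply: (smooth_onM openU)
  end => //; exact: sp.
Qed.

Lemma smooth_divergence : smooth_on U divergence.
Proof.
apply: (smooth_onM openU); first exact: smooth_on_cst.
apply: (smooth_on_sum openU) => i _.
apply: (@smooth_on_eq _ _ _ openU _ (fun y => \sum_j cov_form y i j * invmx (c y) j i)).
  by move=> y _; rewrite [RHS]mxE.
apply: (smooth_on_sum openU) => j _; apply: (smooth_onM openU); first exact: smooth_cov_form.
by apply: smooth_on_invmx => // y /c_metric[].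
Qed.

Lemma smooth_rotation : smooth_on U rotation.
Proof.
apply: (smooth_onM openU); first exact: smooth_on_cst.
apply: (smooth_on_sum openU) => i _.
apply: (@smooth_on_eq _ _ _ openU _ (fun y => \sum_j cov_form y i j *
    \sum_k (\sum_l chi y 0 l * c y l k)
      * vol [tuple delta_mx 0 k; delta_mx 0 i; delta_mx 0 j])).
  move=> y _; rewrite [RHS]mxE; apply: eq_bigr => j _; congr (_ * _).
  rewrite [RHS]mxE mxE (linear_formE (f := fun X => vol [tuple X; _; _])); last first.
    by move=> *; exact: vol3_lin1.
  by apply: eq_bigr => k _; rewrite mxE.
apply: (smooth_on_sum openU) => j _; apply: (smooth_onM openU); first exact: smooth_cov_form.
apply: (smooth_on_sum openU) => k _; apply: (smooth_onM openU); last exact: smooth_on_cst.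
by apply: (smooth_on_sum openU) => l _; apply: (smooth_onM openU); exact: smooth_on_entry.
Qed.

Lemma divergence_rotation y tau kappa : U y -> ip (c y) (chi y) (chi y) = 1 ->
  (forall X Z, ip (c y) (cov c th (-1) X chi y) Z =
    tau * (ip (c y) X Z - ip (c y) (chi y) X * ip (c y) (chi y) Z)
    + kappa * vol [tuple chi y; X; Z]) ->
  divergence y = tau /\ rotation y = kappa.
Proof.
move=> Uy u1 H; have [cs _ _] := c_metric Uy.
have T X Z := etrans (ip_cov_form X Z Uy) (H X Z).
rewrite /divergence /rotation (divergence_trace cs (c_unit Uy) u1 T) (twist_trace cs u1 T).
by split; field.
Qed.

End SmoothCoefficients.

(** * Change of charts on the base *)
Section Charts.
Context {R : realType} {n : nat}.
Variable M : oriented_manifold R n.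

Lemma img_open (i : chart M) : open (img i).
Proof. exact: coord_open (dom_open i) _. Qed.

Lemma overlap_open (i j : chart M) : open (overlap i j).
Proof.
by apply: coord_open; [apply: openI; exact: dom_open|move=> p []].
Qed.

Lemma overlap_img (i j : chart M) u : overlap i j u -> img i u.
Proof. by case=> p [pi pj] <-; exists p. Qed.

Lemma transition_img (i j : chart M) u : overlap i j u -> img j (transition i j u).
Proof. by case=> p [pi pj] <-; exists p => //; rewrite /transition /= coordK. Qed.

Variables (i j : chart M) (u : 'rV[R]_n).
Hypothesis uij : overlap i j u.

Lemma det_jac_gt0 : 0 < \det (jac i j u).
Proof. exact: transition_oriented. Qed.

Lemma rescale_gt0 w : 0 < rescale w i j u.
Proof. by rewrite powR_gt0// normr_gt0 gt_eqF// det_jac_gt0. Qed.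

Lemma rescaleN1 : rescale (-1) i j u = (rescale 1 i j u)^-1.
Proof. by rewrite /rescale mulN1r powRN mul1r. Qed.

Lemma rescale_exp k : rescale k%:R i j u = rescale 1 i j u ^+ k.
Proof.
by rewrite /rescale mul1r mulrC powRrM powR_mulrn// powR_ge0.
Qed.

Lemma rescale_det : (0 < n)%N -> rescale 1 i j u ^+ n = \det (jac i j u).
Proof.
move=> n0; rewrite -rescale_exp /rescale divff ?pnatr_eq0 -?lt0n//.
by rewrite powRr1 ?normr_ge0// gtr0_norm// det_jac_gt0.
Qed.

End Charts.

Section Transition.
Context {R : realType}.
Variable B : oriented_manifold R 3.
Variables (cB : chart B -> 'rV[R]_3 -> 'M[R]_3) (DB chi : chart B -> 'rV[R]_3 -> 'rV[R]_3).
Hypotheses (cB_conformal : conformal_structure cB) (DB_weyl : weyl_derivative DB).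
Hypothesis chi_vector : is_vector (-1) chi.

(** The equation of [shear_free_geodesic] at the point [y], paired with an
    arbitrary vector [Z] *)
Definition congruence_equation (a : chart B) (y : 'rV[R]_3) (tau kappa : R) : Prop :=
  forall X Z, ip (cB a y) (cov (cB a) (DB a) (-1) X (chi a) y) Z =
    tau * (ip (cB a y) X Z - ip (cB a y) (chi a y) X * ip (cB a y) (chi a y) Z)
    + kappa * vol [tuple chi a y; X; Z].

Let metric a y : img a y -> [/\ (cB a y)^T = cB a y,
  forall X, X != 0 -> 0 < ip (cB a y) X X & \det (cB a y) = 1].
Proof. by have [_ _] := cB_conformal; apply. Qed.

Let cB_unit a y : img a y -> cB a y \in unitmx.
Proof. by move=> /metric[_ _ d]; rewrite unitmxE d unitr1. Qed.

Let cB_diff a y : img a y -> differentiable (cB a) y.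
Proof. by have [s _ _] := cB_conformal; exact: smooth_on_differentiable (s a). Qed.

Let cB_sym a y : img a y -> \forall v \near y, (cB a v)^T = cB a v.
Proof. by move=> ay; apply: eq_on_near (ay); [exact: img_open|move=> v /metric[]]. Qed.

Lemma congruence_equationP a y tau kappa : img a y ->
  congruence_equation a y tau kappa <->
  forall X, cov (cB a) (DB a) (-1) X (chi a) y =
    tau *: (X - ip (cB a y) (chi a y) X *: chi a y)
    + kappa *: (X *m star1 (chi a y) *m invmx (cB a y)).
Proof.
move=> ay; have E X Z : ip (cB a y) (tau *: (X - ip (cB a y) (chi a y) X *: chi a y)
    + kappa *: (X *m star1 (chi a y) *m invmx (cB a y))) Z =
    tau * (ip (cB a y) X Z - ip (cB a y) (chi a y) X * ip (cB a y) (chi a y) Z)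
    + kappa * vol [tuple chi a y; X; Z].
  rewrite ipDl !ipZl ipDl ipNl ipZl -ip_star1; congr (_ + _ * _).
  by rewrite /ip mulmxKV// cB_unit.
split=> H X; first by apply: (ip_inj (cB_unit ay)) => Z; rewrite E.
by move=> Z; rewrite H E.
Qed.

Variables (a b : chart B) (y : 'rV[R]_3).
Hypothesis yab : overlap a b y.
Local Notation f := (transition a b).
Local Notation m := (rescale 1 a b).

Let conf v (X Y : 'rV[R]_3) : overlap a b v -> ip (cB b (f v)) ('d f v X) ('d f v Y) =
  m v ^+ 2 * (ip (cB a v) X Y - pairing (cst 0 v) X * pairing (cst 0 v) Y).
Proof.
move=> vab; have [_ /(_ a b v vab) E _] := cB_conformal.
rewrite -!mul_jacobian -rescale_exp /pairing /= trmx0 !mulmx0 !mxE mulr0 subr0 -ipZm -E.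
by rewrite /ip trmx_mul !mulmxA.
Qed.

Let f_smooth : smooth_on (overlap a b) f. Proof. exact: transition_smooth. Qed.
Let m_gt0 v : overlap a b v -> 0 < m v. Proof. by move=> vab; exact: rescale_gt0. Qed.

Let projectable v : overlap a b v -> 'd f v (chi a v) = m v *: chi b (f v).
Proof.
move=> vab; have [_ /(_ a b v vab) ->] := chi_vector.
by rewrite rescaleN1// scalerA mulfV ?gt_eqF ?m_gt0// scale1r -mul_jacobian.
Qed.

(** The transition function of [B] is a conformal projection with [eta = 0], and
    [det (jac a b y) = m^3] accounts for the volume term. *)
Lemma congruence_equation_transition tau kappa :
  congruence_equation b (f y) tau kappa ->
  congruence_equation a y (m y * tau) (m y * kappa).
Proof.
move=> H X Z; have ay := overlap_img yab; have by' := transition_img yab.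
have m0 : m y != 0 by rewrite gt_eqF// m_gt0.
have [chi_s _] := chi_vector.
have dm : differentiable m y.
  apply: (differentiable_factor (@overlap_open _ _ _ a b) f_smooth m_gt0 conf yab
    (cB_diff ay) (cB_diff by') (differentiable_cst _ _) (X := delta_mx 0 0)).
  rewrite /pairing /= trmx0 !mulmx0 !mxE mulr0 subr0 gt_eqF//.
  have [_ pos _] := metric ay; apply: pos.
  by apply/eqP => /matrixP/(_ 0 0)/eqP; rewrite !mxE oner_eq0.
have [_ weyl] := DB_weyl.
have hor (W : 'rV[R]_3) : pairing (cst 0 y) W = 0 :> R by rewrite /pairing /= trmx0 mulmx0 mxE.
have P := ip_cov_pullback (@overlap_open _ _ _ a b) f_smooth m_gt0 conf yab
    (cB_diff ay) (cB_diff by') (differentiable_cst _ _) dm (weyl a b y yab)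
    (cB_sym by') (cB_unit ay) (cB_unit by')
    (smooth_on_differentiable (chi_s a) ay) (smooth_on_differentiable (chi_s b) by')
    projectable (hor X) (hor (chi a y)) (hor Z).
apply: (mulfI m0); rewrite -P H.
have chiE : chi b (f y) = (m y)^-1 *: 'd f y (chi a y).
  by rewrite projectable// scalerA mulVf// scale1r.
have volE : vol [tuple 'd f y (chi a y); 'd f y X; 'd f y Z] =
    m y ^+ 3 * vol [tuple chi a y; X; Z].
  by rewrite -!mul_jacobian vol3_mulmx rescale_det// mulrC.
have -> : vol [tuple chi b (f y); 'd f y X; 'd f y Z] =
    (m y)^-1 * vol [tuple 'd f y (chi a y); 'd f y X; 'd f y Z].
  rewrite chiE -[X in vol [tuple X; _; _]]addr0 vol3_lin1.
  have -> : vol [tuple 0; 'd f y X; 'd f y Z] = 0; last by rewrite addr0.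
  have := vol3_lin1 ('d f y X) ('d f y Z) (-1) 0 0.
  by rewrite scaler0 addr0 mulN1r addNr.
by rewrite volE chiE !ipZl !conf// !hor !mul0r !subr0; field.
Qed.

End Transition.

(** * Descent along the submersion *)
Section Submersion.
Context {R : realType}.
Variables (M : oriented_manifold R 4) (B : oriented_manifold R 3).
Variables (c : chart M -> 'rV[R]_4 -> 'M[R]_4) (xi D0 : chart M -> 'rV[R]_4 -> 'rV[R]_4).
Variables (cB : chart B -> 'rV[R]_3 -> 'M[R]_3).
Variables (pi : M -> B) (mu : chart M -> chart B -> 'rV[R]_4 -> R).
Variables (J : chart M -> 'rV[R]_4 -> 'M[R]_4) (DB chi : chart B -> 'rV[R]_3 -> 'rV[R]_3).
Hypotheses (c_conformal : conformal_structure c) (xi_congruence : congruence c xi).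
Hypothesis D0_minimal : minimal_weyl c xi D0.
Hypothesis cB_conformal : conformal_structure cB.
Hypothesis pi_submersion : conformal_submersion c xi cB pi mu.
Hypothesis DB_weyl : weyl_derivative DB.
Hypothesis DB_pullback : weyl_pullback pi mu (weyl_basic c xi D0) DB.
Hypotheses (J_asd : asd_almost_complex c J) (J_invariant : invariant_endo xi D0 J).
Hypothesis chi_vector : is_vector (-1) chi.
Hypothesis chi_pullback : vector_pullback c xi pi mu (-1) (chi_of xi J) chi.

Lemma common_img_open i a : open (common_img pi i a).
Proof.
apply: coord_open; last by move=> p [].
apply: openI; first exact: dom_open.
apply: open_comp; last exact: dom_open.
by move=> p _; apply: csub_continuous pi_submersion p.
Qed.

Lemma common_img_img i a u : common_img pi i a u -> img i u.
Proof. by case=> p [pi_ _] <-; exists p. Qed.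

Lemma local_rep_img i a u : common_img pi i a u -> img a (local_rep pi i a u).
Proof. by case=> p [pp qp] <-; exists (pi p) => //; rewrite /local_rep /= coordK. Qed.

Lemma common_img_cover i u : img i u -> exists a, common_img pi i a u.
Proof. by case=> p pp <-; have [a ap] := dom_cover (pi p); exists a, p. Qed.

Lemma local_rep_cover a y : img a y -> exists i u, common_img pi i a u /\ local_rep pi i a u = y.
Proof.
case=> q qa <-; have [p pq] := csub_surjective pi_submersion q.
have [i di] := dom_cover p; exists i, (Defs.coord i p); split.
  by exists p => //; split => //=; rewrite pq.
by rewrite /local_rep /= coordK// pq.
Qed.

(** The lift to [M] of [congruence_equation], as [*1 = *_B 1 /\ xi] *)
Definition horizontal_equation (i : chart M) (u : 'rV[R]_4) (tau kappa : R) : Prop :=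
  forall X Z, ip (c i u) (xi i u) X = 0 -> ip (c i u) (xi i u) Z = 0 ->
    ip (c i u) (cov (c i) (weyl_basic c xi D0 i) (-1) X (chi_of xi J i) u) Z =
    tau * (ip (c i u) X Z - ip (c i u) (chi_of xi J i u) X * ip (c i u) (chi_of xi J i u) Z)
    + kappa * vol [tuple chi_of xi J i u; X; Z; xi i u].

Let c_metric i u : img i u -> [/\ (c i u)^T = c i u,
  forall X, X != 0 -> 0 < ip (c i u) X X & \det (c i u) = 1].
Proof. by have [_ _] := c_conformal; apply. Qed.

Let cB_metric a y : img a y -> [/\ (cB a y)^T = cB a y,
  forall X, X != 0 -> 0 < ip (cB a y) X X & \det (cB a y) = 1].
Proof. by have [_ _] := cB_conformal; apply. Qed.

Let c_smooth i : smooth_on (img i) (c i). Proof. by have [] := c_conformal. Qed.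
Let J_smooth i : smooth_on (img i) (J i). Proof. by have [[]] := J_asd. Qed.
Let xi_smooth i : smooth_on (img i) (xi i). Proof. by have [[]] := xi_congruence. Qed.
Let cB_smooth a : smooth_on (img a) (cB a). Proof. by have [] := cB_conformal. Qed.
Let chi_smooth a : smooth_on (img a) (chi a). Proof. by have [] := chi_vector. Qed.
Let xi_unit i u : img i u -> ip (c i u) (xi i u) (xi i u) = 1.
Proof. by have [_] := xi_congruence; apply. Qed.

Let invariant_at i u Y : img i u -> weyl_lie (xi i) (D0 i) (cst 1) (J i) Y u = 0.
Proof.
move=> iu; apply: J_invariant => //; first by apply: smooth_on_cst; exact: img_open.
by move=> v _; exact: oner_neq0.
Qed.

Lemma parallel_endo_at tau kappa i u : img i u ->
  (forall X Y, cov_endo (c i) (weyl_twisted c xi D0 J tau kappa i) X (J i) Y u = 0) <->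
  horizontal_equation i u (tau i u) (kappa i u).
Proof.
move=> iu; have [_ D0_min] := D0_minimal; have [_ J_at] := J_asd.
have H := parallel_at_iff (@img_open _ _ _ i) iu (@c_smooth i) (@J_smooth i) (@xi_smooth i)
  (@c_metric i) (@xi_unit i) (J_at i) (D0_min i u iu) (fun Y => @invariant_at i u Y iu)
  (tau := tau i u) (kappa := kappa i u)
  (th' := weyl_twisted c xi D0 J tau kappa i) (thB := weyl_basic c xi D0 i).
apply: H => //; by rewrite /weyl_twisted /weyl_sd /twist !addrA.
Qed.

Lemma integrable_endo_at i u : img i u ->
  (forall X Y, nijenhuis (J i) X Y u = 0) <->
  exists tau kappa, horizontal_equation i u tau kappa.
Proof.
move=> iu; have [_ D0_min] := D0_minimal; have [_ J_at] := J_asd.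
by apply: (integrable_at_iff (@img_open _ _ _ i) iu (@c_smooth i) (@J_smooth i) (@xi_smooth i)
  (@c_metric i) (@xi_unit i) (J_at i) (D0_min i u iu) (fun Y => @invariant_at i u Y iu)).
Qed.

Section CommonChart.
Variables (i : chart M) (a : chart B).
Local Notation U := (common_img pi i a).
Local Notation f := (local_rep pi i a).
Local Notation m := (mu i a).

Let f_smooth : smooth_on U f. Proof. exact: csub_smooth pi_submersion i a. Qed.
Let m_gt0 v : U v -> 0 < m v. Proof. exact: csub_factor_gt0 pi_submersion i a v. Qed.

Definition horizontal_part v (X : 'rV[R]_4) := X - ip (c i v) (xi i v) X *: xi i v.

Lemma horizontal_partP v X : U v -> ip (c i v) (xi i v) (horizontal_part v X) = 0.
Proof.
by move=> /common_img_img iv; rewrite ipDr ipNr ipZr xi_unit// mulr1 subrr.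
Qed.

Lemma diff_horizontal_part v X : U v -> 'd f v (horizontal_part v X) = 'd f v X.
Proof.
move=> Uv; rewrite linearB linearZ /= (csub_tangent pi_submersion Uv).
by rewrite scaler0 subr0.
Qed.

Let conf v X Y : U v -> ip (cB a (f v)) ('d f v X) ('d f v Y) =
  m v ^+ 2 * (ip (c i v) X Y - pairing (flat c xi i v) X * pairing (flat c xi i v) Y).
Proof.
move=> Uv; have iv := common_img_img Uv; have [cs _ _] := c_metric iv.
rewrite -(diff_horizontal_part X Uv) -(diff_horizontal_part Y Uv).
rewrite (csub_conformal pi_submersion Uv) ?horizontal_partP//; congr (_ * _).
rewrite [X in ip _ X]/horizontal_part ipDl ipNl ipZl horizontal_partP// mulr0 subr0.
by rewrite /horizontal_part ipDr ipNr ipZr (ip_sym X (xi i v) cs) !pairing_ip mulrC.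
Qed.

Let projectable v : U v -> 'd f v (chi_of xi J i v) = m v *: chi a (f v).
Proof.
by move=> Uv; have [_ ->] := chi_pullback Uv; rewrite opprK powRr1// ltW// m_gt0.
Qed.

Variable u : 'rV[R]_4.
Hypothesis Uu : U u.
Let iu : img i u := common_img_img Uu.
Let ay : img a (f u) := local_rep_img Uu.

Let dflat : differentiable (flat c xi i) u.
Proof.
by apply: differentiable_mulmx;
  [exact: smooth_on_differentiable (@xi_smooth i) iu
  |exact: smooth_on_differentiable (@c_smooth i) iu].
Qed.

Let dm : differentiable m u.
Proof.
have [cs pos _] := c_metric iu.
have [e [e1 e0 _]] := orthogonal_unit_exists (xi i u) (xi i u) cs pos.
apply: (differentiable_factor (@common_img_open i a) f_smooth m_gt0 conf Uu
  (smooth_on_differentiable (@c_smooth i) iu) (smooth_on_differentiable (@cB_smooth a) ay)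
  dflat (X := e)).
by rewrite !pairing_ip e0 e1 mulr0 subr0 oner_neq0.
Qed.

Let c_unit : c i u \in unitmx.
Proof. by have [_ _ d] := c_metric iu; rewrite unitmxE d unitr1. Qed.
Let cB_unit : cB a (f u) \in unitmx.
Proof. by have [_ _ d] := cB_metric ay; rewrite unitmxE d unitr1. Qed.

Let chi_horizontal : ip (c i u) (xi i u) (chi_of xi J i u) = 0.
Proof. by have [] := chi_pullback Uu. Qed.

Let ip_cov_basic X Z : ip (c i u) (xi i u) X = 0 -> ip (c i u) (xi i u) Z = 0 ->
  ip (cB a (f u)) (cov (cB a) (DB a) (-1) ('d f u X) (chi a) (f u)) ('d f u Z) =
  m u * ip (c i u) (cov (c i) (weyl_basic c xi D0 i) (-1) X (chi_of xi J i) u) Z.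
Proof.
move=> hX hZ.
apply: (ip_cov_pullback (@common_img_open i a) f_smooth m_gt0 conf Uu
  (smooth_on_differentiable (@c_smooth i) iu) (smooth_on_differentiable (@cB_smooth a) ay)
  dflat dm (DB_pullback Uu) _ c_unit cB_unit _
  (smooth_on_differentiable (@chi_smooth a) ay) projectable); rewrite ?pairing_ip//.
- by apply: eq_on_near (ay); [exact: img_open|move=> v /cB_metric[]].
- apply: differentiable_mulmx; first exact: smooth_on_differentiable (@xi_smooth i) iu.
  exact: smooth_on_differentiable (@J_smooth i) iu.
Qed.

Let chiE : chi a (f u) = (m u)^-1 *: 'd f u (chi_of xi J i u).
Proof. by rewrite projectable// scalerA mulVf ?gt_eqF ?m_gt0// scale1r. Qed.

Let right_hand_side tau kappa X Z :
  ip (c i u) (xi i u) X = 0 -> ip (c i u) (xi i u) Z = 0 ->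
  tau * (ip (cB a (f u)) ('d f u X) ('d f u Z)
    - ip (cB a (f u)) (chi a (f u)) ('d f u X) * ip (cB a (f u)) (chi a (f u)) ('d f u Z))
  + kappa * vol [tuple chi a (f u); 'd f u X; 'd f u Z] =
  m u * (m u * tau * (ip (c i u) X Z
    - ip (c i u) (chi_of xi J i u) X * ip (c i u) (chi_of xi J i u) Z)
  + m u * kappa * vol [tuple chi_of xi J i u; X; Z; xi i u]).
Proof.
move=> hX hZ; have m0 : m u != 0 by rewrite gt_eqF// m_gt0.
have -> : vol [tuple chi a (f u); 'd f u X; 'd f u Z] =
    (m u)^-1 * vol [tuple 'd f u (chi_of xi J i u); 'd f u X; 'd f u Z].
  rewrite chiE -[X in vol [tuple X; _; _]]addr0 vol3_lin1.
  have -> : vol [tuple 0; 'd f u X; 'd f u Z] = 0; last by rewrite addr0.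
  have := vol3_lin1 ('d f u X) ('d f u Z) (-1) 0 0.
  by rewrite scaler0 addr0 mulN1r addNr.
rewrite (csub_orientation pi_submersion Uu) chiE !ipZl !conf// !pairing_ip hX hZ.
by rewrite !mulr0 !subr0; field.
Qed.

(** Horizontal vectors project onto all of [TB], and by [ip_cov_basic] and
    [right_hand_side] both sides acquire the factor [mu]; the other factor [mu]
    in front of [tau] and [kappa] is the pullback of sections of [L_B^-1]. *)
Lemma horizontal_equationP tau kappa :
  horizontal_equation i u (m u * tau) (m u * kappa) <->
  congruence_equation cB DB chi a (f u) tau kappa.
Proof.
have m0 : m u != 0 by rewrite gt_eqF// m_gt0.
split=> [H X' Z'|H X Z hX hZ].
  have [X dX] := csub_submersion pi_submersion Uu X'.
  have [Z dZ] := csub_submersion pi_submersion Uu Z'.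
  rewrite -dX -dZ -(diff_horizontal_part X Uu) -(diff_horizontal_part Z Uu).
  have hX := horizontal_partP X Uu; have hZ := horizontal_partP Z Uu.
  by rewrite ip_cov_basic// H// right_hand_side.
by apply: (mulfI m0); rewrite -ip_cov_basic// -right_hand_side.
Qed.

Lemma chi_unit : ip (cB a (f u)) (chi a (f u)) (chi a (f u)) = 1.
Proof.
have m0 : m u != 0 by rewrite gt_eqF// m_gt0.
have [_ J_at] := J_asd; have [J2 sk _] := J_at i u iu.
have E X Y : ip (J i u *m c i u) X Y = ip (c i u) (X *m J i u) Y by rewrite /ip mulmxA.
have -> : ip (cB a (f u)) (chi a (f u)) (chi a (f u)) =
    ip (c i u) (chi_of xi J i u) (chi_of xi J i u).
  by rewrite chiE ipZl ipZr conf// !pairing_ip chi_horizontal mulr0 subr0; field.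
rewrite -[in LHS]E -ip_tr sk -scaleN1r ipZm E /chi_of -mulmxA J2 mulmxN mulmx1.
by rewrite ipNl mulN1r opprK xi_unit.
Qed.

End CommonChart.

Lemma parallel_iff (tau kappa : chart M -> 'rV[R]_4 -> R)
    (tauB kappaB : chart B -> 'rV[R]_3 -> R) :
  density_pullback pi mu (-1) tau tauB -> density_pullback pi mu (-1) kappa kappaB ->
  parallel_endo c (weyl_twisted c xi D0 J tau kappa) J <->
  shear_free_geodesic cB DB chi tauB kappaB.
Proof.
move=> tauE kappaE.
have E i a u (Uu : common_img pi i a u) :
    horizontal_equation i u (tau i u) (kappa i u) <->
    congruence_equation cB DB chi a (local_rep pi i a u) (tauB a (local_rep pi i a u))
      (kappaB a (local_rep pi i a u)).
  rewrite (tauE _ _ _ Uu) (kappaE _ _ _ Uu) opprK powRr1; first exact: horizontal_equationP.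
  by rewrite ltW// (csub_factor_gt0 pi_submersion Uu).
split=> [P a y X ay|S i u X Y iu].
  have [i [u [Uu uy]]] := local_rep_cover ay; rewrite -uy in ay *.
  have iu := common_img_img Uu.
  apply: (congruence_equationP DB chi cB_conformal _ _ ay).1; apply/(E _ _ _ Uu).
  by apply/parallel_endo_at => // X' Y'; exact: P.
have [a Uu] := common_img_cover iu; have ay := local_rep_img Uu.
move: X Y; apply/(parallel_endo_at _ _ iu)/(E _ _ _ Uu).
by apply/(congruence_equationP DB chi cB_conformal _ _ ay) => X; exact: S.
Qed.

(** Integrability yields [tau] and [kappa] at each point of [M], thus at each
    point of [B] by surjectivity; their expression through [D^B chi] alone makes
    them functions on [B]. *)
Lemma integrable_iff : integrable_endo J <->
  exists tauB kappaB : chart B -> 'rV[R]_3 -> R,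
    [/\ is_density (-1) tauB, is_density (-1) kappaB &
        shear_free_geodesic cB DB chi tauB kappaB].
Proof.
split=> [N|[tauB [kappaB [_ _ S]]] i u X Y iu]; last first.
  have [a Uu] := common_img_cover iu; have ay := local_rep_img Uu.
  move: X Y; apply/(integrable_endo_at iu).
  exists (mu i a u * tauB a (local_rep pi i a u)), (mu i a u * kappaB a (local_rep pi i a u)).
  apply/(horizontal_equationP Uu).
  by apply/(congruence_equationP DB chi cB_conformal _ _ ay) => X; exact: S.
pose tauB a := divergence (cB a) (DB a) (chi a).
pose kappaB a := rotation (cB a) (DB a) (chi a).
have [DB_s _] := DB_weyl.
(* [chi] has unit length on [B] because every point of [B] lies under one of [M]. *)
have unique a y t k : img a y -> congruence_equation cB DB chi a y t k ->
    tauB a y = t /\ kappaB a y = k.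
  move=> ay H; apply: (divergence_rotation (@cB_smooth a) (@chi_smooth a) (@cB_metric a)) => //.
  by have [i [u [Uu <-]]] := local_rep_cover ay; exact: chi_unit.
have exist a y : img a y -> congruence_equation cB DB chi a y (tauB a y) (kappaB a y).
  move=> ay; have [i [u [Uu uy]]] := local_rep_cover ay; have iu := common_img_img Uu.
  have [t [k H]] := (integrable_endo_at iu).1 (fun X Y => N i u X Y iu).
  have m0 : mu i a u != 0 by rewrite gt_eqF// (csub_factor_gt0 pi_submersion Uu).
  have {}H : congruence_equation cB DB chi a y ((mu i a u)^-1 * t) ((mu i a u)^-1 * k).
    by rewrite -uy; apply/(horizontal_equationP Uu); rewrite !mulVKf.
  by have [-> ->] := unique a y _ _ ay H.
have trans a b y : overlap a b y -> tauB b (transition a b y) = rescale (-1) a b y * tauB a y /\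
    kappaB b (transition a b y) = rescale (-1) a b y * kappaB a y.
  move=> yab; have H := exist b _ (transition_img yab).
  have {}H := congruence_equation_transition cB_conformal DB_weyl chi_vector yab H.
  have [-> ->] := unique a y _ _ (overlap_img yab) H.
  have m0 : rescale 1 a b y != 0 by rewrite gt_eqF// rescale_gt0.
  by rewrite rescaleN1 !mulKf.
exists tauB, kappaB; split.
- split=> [a|a b y /trans[]//].
  exact: (smooth_divergence (@img_open _ _ _ a) (@cB_smooth a) (DB_s a) (@chi_smooth a) (@cB_metric a)).
- split=> [a|a b y /trans[]//].
  exact: (smooth_rotation (@img_open _ _ _ a) (@cB_smooth a) (DB_s a) (@chi_smooth a) (@cB_metric a)).
- by move=> a y X ay; apply: (congruence_equationP DB chi cB_conformal _ _ ay).1; exact: exist.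
Qed.

End Submersion.

Theorem mainTheorem2 (R : realType)
    (M : oriented_manifold R 4) (B : oriented_manifold R 3)
    (c : chart M -> 'rV[R]_4 -> 'M[R]_4)
    (xi D0 : chart M -> 'rV[R]_4 -> 'rV[R]_4)
    (cB : chart B -> 'rV[R]_3 -> 'M[R]_3)
    (pi : M -> B) (mu : chart M -> chart B -> 'rV[R]_4 -> R)
    (J : chart M -> 'rV[R]_4 -> 'M[R]_4)
    (DB chi : chart B -> 'rV[R]_3 -> 'rV[R]_3) :
  conformal_structure c ->
  congruence c xi ->
  minimal_weyl c xi D0 ->
  conformal_structure cB ->
  conformal_submersion c xi cB pi mu ->
  selfdual_congruence c D0 ->
  (* DB is the Weyl derivative on B whose pullback is D^B = D^0 + omega *)
  weyl_derivative DB ->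
  weyl_pullback pi mu (weyl_basic c xi D0) DB ->
  asd_almost_complex c J ->
  invariant_endo xi D0 J ->
  (* chi is the section of L_B^-1 TB to which J xi descends *)
  is_vector (-1) chi ->
  vector_pullback c xi pi mu (-1) (chi_of xi J) chi ->
  (forall (tau kappa : chart M -> 'rV[R]_4 -> R)
          (tauB kappaB : chart B -> 'rV[R]_3 -> R),
     is_density (-1) tau -> is_density (-1) kappa ->
     is_density (-1) tauB -> is_density (-1) kappaB ->
     density_pullback pi mu (-1) tau tauB ->
     density_pullback pi mu (-1) kappa kappaB ->
     (parallel_endo c (weyl_twisted c xi D0 J tau kappa) J <->
      shear_free_geodesic cB DB chi tauB kappaB)) /\
  (integrable_endo J <->
   exists tauB kappaB : chart B -> 'rV[R]_3 -> R,
     [/\ is_density (-1) tauB, is_density (-1) kappaB &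
         shear_free_geodesic cB DB chi tauB kappaB]).
Proof.
move=> c_conf xi_cong D0_min cB_conf sub _ DB_weyl DB_pull J_asd J_inv chi_vec chi_pull.
split=> [tau kappa tauB kappaB _ _ _ _|].
  exact: (parallel_iff c_conf xi_cong D0_min cB_conf sub DB_pull J_asd J_inv chi_vec chi_pull).
exact: (integrable_iff c_conf xi_cong D0_min cB_conf sub DB_weyl DB_pull J_asd J_inv chi_vec chi_pull).
Qed.
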